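(* For all $i,j\in\{0,1,2,3\}$ and all $1\le r,s\le n$, $$\bigl[D_n^r(h^i),\,D_n^s(h^j)\bigr]=0$$ as operators on symmetric polynomials in $x_1,\dots,x_n$.
   Context: Macdonald operators: for $1\le r\le n$, $$D_n^r=t^{r(r-1)/2}\sum_{I\subset\{1,\dots,n\},\,|I|=r}\ \prod_{i\in I,\,j\notin I}\frac{t x_i-x_j}{x_i-x_j}\ \prod_{i\in I}T_{q,x_i},\qquad T_{q,x_i}f(x_1,\dots,x_i,\dots,x_n)=f(x_1,\dots,qx_i,\dots,x_n),$$ acting on symmetric functions (polynomials) in $x_1,\dots,x_n$. Put $q=\exp(h)$, $t=\exp(\beta h)$ with $\beta$ a parameter, so $T_{q,x_i}=\exp(h\,x_i\partial_i)$, $\partial_i=\partial/\partial x_i$, and expand around $h=0$: $D_n^r=\sum_{k\ge0}D_n^r(h^k)\,h^k$; thus $D_n^r(h^k)$ is the coefficient of $h^k$. $[A,B]=AB-BA$. *)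

(* Defs.v *)
From HB Require Import structures.
From mathcomp Require Import all_boot all_order all_algebra.
From mathcomp Require Import ring.
From mathcomp Require Export mpoly.

Set Implicit Arguments.
Unset Strict Implicit.
Unset Printing Implicit Defensive.

Import GRing.Theory.
Local Open Scope ring_scope.

(* K(x_1, ..., x_n); the variables are indexed from 0. *)
Notation ratfun K n := ({fraction {mpoly K[n]}}).

Section Derivations.
Variables (K : fieldType) (n : nat).
Implicit Types (f p : {mpoly K[n]}) (u v : ratfun K n) (i : 'I_n).

Definition ratconst (c : K) : ratfun K n := FracField.tofrac c%:MP.
Definition ratvar i : ratfun K n := FracField.tofrac 'X_i.

(* Quotient rule on a representative a / b of u; the choice of representative
   is immaterial by rderiv_frac below. *)
Definition rderiv i u : ratfun K n :=
  let a : {mpoly K[n]} := \n_(repr u) in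
  let b : {mpoly K[n]} := \d_(repr u) in
  FracField.tofrac (mderiv i a * b - a * mderiv i b) / FracField.tofrac (b ^+ 2).

(* x_i d/dx_i *)
Definition euler i u : ratfun K n := ratvar i * rderiv i u.

Lemma reprE u :
  u = FracField.tofrac (\n_(repr u) : {mpoly K[n]}) / FracField.tofrac \d_(repr u).
Proof.
apply: (canRL (mulfK _)); first by rewrite tofrac_eq0 denom_ratioP.
rewrite -{1}[u]reprK; case: (repr u) => -[a b] /= b0.
unlock FracField.tofrac; rewrite -[LHS]FracField.pi_mul.
apply/eqmodP; rewrite /= FracField.equivfE /FracField.mulf /=.
by rewrite !numden_Ratio ?mulr1 ?oner_eq0 ?mul1r // mulrC.
Qed.

Lemma rderiv_frac i p f : f != 0 ->
  rderiv i (FracField.tofrac p / FracField.tofrac f)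
  = FracField.tofrac (mderiv i p * f - p * mderiv i f) / FracField.tofrac (f ^+ 2).
Proof.
move=> f0; set u := _ / _; rewrite /rderiv.
set a : {mpoly K[n]} := \n_(repr u); set b : {mpoly K[n]} := \d_(repr u).
have b0 : b != 0 by exact: denom_ratioP.
have fF : FracField.tofrac f != 0 by rewrite tofrac_eq0.
have bF : FracField.tofrac b != 0 by rewrite tofrac_eq0.
have ab : a * f = p * b.
  have /eqP := reprE u; rewrite -/a -/b {1}/u (eqr_div _ _ fF bF).
  by rewrite -!tofracM tofrac_eq eq_sym => /eqP.
have dab : mderiv i a * f + a * mderiv i f = mderiv i p * b + p * mderiv i b.
  by rewrite -!mderivM ab.
apply/eqP; rewrite eqr_div ?tofrac_eq0 ?expf_neq0 // -!tofracM tofrac_eq.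
apply/eqP.
have -> : (mderiv i a * b - a * mderiv i b) * f ^+ 2
  = b * f * (mderiv i a * f + a * mderiv i f)
    - (a * f) * (b * mderiv i f + f * mderiv i b) by ring.
by rewrite dab ab; ring.
Qed.

Lemma rderiv_tofrac i f :
  rderiv i (FracField.tofrac f) = FracField.tofrac (mderiv i f).
Proof.
have := rderiv_frac i f (oner_neq0 {mpoly K[n]}).
by rewrite tofrac1 divr1 expr1n tofrac1 divr1 => ->;
   rewrite -mpolyC1 mderivC mulr0 subr0 mulr1.
Qed.

End Derivations.

(* A formal power series \sum_k s_k h^k over A is its coefficient sequence. *)
Section Series.
Variable A : fieldType.
Implicit Types s : nat -> A.

Definition sconst (c : A) : nat -> A := fun k => if k == 0%N then c else 0.
Definition sadd s1 s2 : nat -> A := fun k => s1 k + s2 k.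
Definition smul s1 s2 : nat -> A := fun k => \sum_(a < k.+1) s1 a * s2 (k - a)%N.
Definition spow s m : nat -> A := iter m (smul s) (sconst 1).
(* exp(c h) *)
Definition sexp (c : A) : nat -> A := fun k => c ^+ k / k`!%:R.

(* A formal power series in h whose coefficients are operators on A. *)
Definition opseries := nat -> A -> A.
Implicit Types X Y : opseries.

Definition opone : opseries := fun k f => if k == 0%N then f else 0.
Definition opcomp X Y : opseries :=
  fun k f => \sum_(a < k.+1) X a (Y (k - a)%N f).
Definition opscale s X : opseries :=
  fun k f => \sum_(a < k.+1) s a * X (k - a)%N f.
(* exp(h L) *)
Definition opexp (L : A -> A) : opseries := fun k f => iter k L f / k`!%:R.

Definition opcommutator (L M : A -> A) : A -> A := fun f => L (M f) - M (L f).

End Series.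

Section Macdonald.
Variables (K : fieldType) (n : nat) (beta : K).
Local Notation F := (ratfun K n).

Definition tseries : nat -> F := sexp (ratconst n beta).

Definition qshift (i : 'I_n) : opseries F := opexp (@euler K n i).

(* (t x_i - x_j) / (x_i - x_j) *)
Definition factor (i j : 'I_n) : nat -> F :=
  smul (sadd (smul tseries (sconst (ratvar K i))) (sconst (- ratvar K j)))
       (sconst (ratvar K i - ratvar K j)^-1).

Definition macdonald_term (I : {set 'I_n}) : opseries F :=
  opscale (\big[@smul F/sconst 1]_(i in I) \big[@smul F/sconst 1]_(j in ~: I) factor i j)
          (\big[@opcomp F/@opone F]_(i in I) qshift i).

(* macdonald r k is the coefficient of h^k in D_n^r. *)
Definition macdonald (r : nat) : opseries F :=
  opscale (spow tseries ((r * r.-1)./2)%N)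
          (fun k f => \sum_(I : {set 'I_n} | #|I| == r) macdonald_term I k f).

(* exp(h x_i d/dx_i) is the substitution x_i |-> q x_i with q = exp(h). *)
Lemma qshift_monomial (i : 'I_n) (m : 'X_{1..n}) (k : nat) :
  qshift i k (FracField.tofrac 'X_[m])
  = sexp (m i)%:R k * FracField.tofrac 'X_[m].
Proof.
rewrite /qshift /opexp /sexp mulrAC; congr (_ / _).
elim: k => [|k IH] /=; first by rewrite mul1r.
rewrite IH exprS -natrX -natrM mulr_natl -tofracMn /euler rderiv_tofrac /ratvar.
rewrite [RHS]mulr_natl -tofracM -tofracMn; congr FracField.tofrac.
rewrite mderivMn mderivX scaler_nat -mulrnA mulrnAr -mpolyXD.
have [->|mi_gt0] := posnP (m i); first by rewrite !mul0n !mulr0n.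
by rewrite addmC submK // lep1mP -lt0n.
Qed.

End Macdonald.

(* Main.v *)
Require Import Defs.
From HB Require Import structures.
From mathcomp Require Import all_boot all_order all_algebra.
From mathcomp Require Import ring mpoly.

Set Implicit Arguments.
Unset Strict Implicit.
Unset Printing Implicit Defensive.

Import GRing.Theory.
Local Open Scope ring_scope.

(* Put b = beta/2, w_ij = (x_i + x_j)/(x_i - x_j) and D_i = x_i d/dx_i. Since
     t^(-1/2) (t x_i - x_j)/(x_i - x_j) = cosh(bh) + w_ij sinh(bh),
   D_n^r is, up to a scalar power series in h, a sum over I of the exponentials
   of explicit series. As w is antisymmetric, the sum of w_ij over i in I and
   j outside I is the sum over i in I of W_i = sum_j w_ij, so that the
   coefficients of h^0, ..., h^3 are sums over I of expressions of degree at
   most 3 in the indicator function of I. Such a sum depends on r only through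
   the numbers of r-subsets containing 1, 2 or 3 given points. The relation
     w_ij w_jk + w_jk w_ki + w_ki w_ij = -1
   then turns the four coefficients into combinations, with constant
   coefficients depending on r, of products of three operators independent of
   r: E = sum_i D_i, the Calogero-Sutherland operator H and a third-order
   operator H_3. The latter two are (up to a multiple of E) the sums of all
   entries of L^2 and L^3 for the Calogero-Sutherland Lax matrix L. The Lax
   equation [H, L] = [M, L], where the rows and columns of M sum to zero, shows
   that H commutes with H_3. *)

(** * Power series modulo h^4 *)

Section CubicTruncation.
Variable A : fieldType.
Hypothesis two_neq0 : 2%:R != 0 :> A.
Hypothesis three_neq0 : 3%:R != 0 :> A.
Implicit Types (s : nat -> A) (X : opseries A) (L : A -> A).

(* s = exp(a1 h + a2 h^2 + a3 h^3) mod h^4 *)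
Definition exp3 s (a1 a2 a3 : A) :=
  [/\ s 0%N = 1, s 1%N = a1, s 2%N = a2 + a1 ^+ 2 / 2%:R
    & s 3%N = a3 + a1 * a2 + a1 ^+ 3 / 6%:R].

(* X = exp(h L) mod h^4 *)
Definition opexp3 X L := forall f, [/\ X 0%N f = f, X 1%N f = L f,
  X 2%N f = L (L f) / 2%:R & X 3%N f = L (L (L f)) / 6%:R].

Lemma six_neq0 : 6%:R != 0 :> A.
Proof. by rewrite (natrM A 2 3) mulf_neq0. Qed.

Lemma exp3_one : exp3 (sconst 1) 0 0 0.
Proof. by split; rewrite /sconst /= ?mul0r ?add0r ?expr0n ?mul0r. Qed.

(** Exponents add under multiplication, which is why a series is recorded by the coefficients of its
    logarithm. *)
Lemma exp3_mul s s' a1 a2 a3 c1 c2 c3 : exp3 s a1 a2 a3 -> exp3 s' c1 c2 c3 ->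
  exp3 (smul s s') (a1 + c1) (a2 + c2) (a3 + c3).
Proof.
move=> [s0 s1 s2 s3] [t0 t1 t2 t3].
split; rewrite /smul !big_ord_recl big_ord0 /= ?subSS ?subn0 /bump /=
  ?s0 ?s1 ?s2 ?s3 ?t0 ?t1 ?t2 ?t3.
- by ring.
- by ring.
- by field.
- by field; rewrite six_neq0.
Qed.

Lemma exp3_prod (J : Type) (r : seq J) (P : pred J) (s : J -> nat -> A) (a1 a2 a3 : J -> A) :
  (forall i, P i -> exp3 (s i) (a1 i) (a2 i) (a3 i)) ->
  exp3 (\big[@smul A/sconst 1]_(i <- r | P i) s i) (\sum_(i <- r | P i) a1 i)
    (\sum_(i <- r | P i) a2 i) (\sum_(i <- r | P i) a3 i).
Proof.
move=> es; elim: r => [|i r IHr]; first by rewrite !big_nil; apply: exp3_one.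
by rewrite !big_cons; case: ifP => // Pi; apply: exp3_mul => //; apply: es.
Qed.

Lemma exp3_pow s a1 a2 a3 k : exp3 s a1 a2 a3 ->
  exp3 (spow s k) (k%:R * a1) (k%:R * a2) (k%:R * a3).
Proof.
move=> es; elim: k => [|k IHk]; first by rewrite !mul0r; apply: exp3_one.
by rewrite -natr1 !(mulrDl k%:R) !mul1r ![k%:R * _ + _]addrC; apply: exp3_mul.
Qed.

Lemma exp3_sexp c : exp3 (sexp c) c 0 0.
Proof.
split; rewrite /sexp /= ?fact0 ?expr0 ?divr1 ?expr1 ?add0r ?mulr0 ?add0r //.
Qed.

Lemma eq_opexp3 X L M : L =1 M -> opexp3 X L -> opexp3 X M.
Proof. by move=> e eX f; have [] := eX f; rewrite !e. Qed.

Lemma opexp3_one : opexp3 (@opone A) (fun=> 0).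
Proof. by move=> f; split; rewrite /opone /= ?mul0r. Qed.

Lemma opexp3_exp L : opexp3 (opexp L) L.
Proof. by move=> f; split; rewrite /opexp /= ?divr1. Qed.

(** Since [L] and [M] commute, exp(h L) exp(h M) = exp(h (L + M)). *)
Lemma opexp3_comp X Y (L : {additive A -> A}) M :
  (forall f, L (M f) = M (L f)) -> (forall x y, M (x + y) = M x + M y) ->
  opexp3 X L -> opexp3 Y M -> opexp3 (opcomp X Y) (fun f => L f + M f).
Proof.
move=> LM MD eX eY f; have [Y0 Y1 Y2 Y3] := eY f.
(* Additivity alone moves [L] past a division by 2, because doubling is a sum. *)
have half x : L (x / 2%:R) = L x / 2%:R.
  by apply: (mulIf two_neq0); rewrite divfK // mulr_natr -raddfMn -(mulr_natr (x / _)) divfK.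
split; rewrite /opcomp !big_ord_recl big_ord0 /= ?subSS ?subn0 /bump /= ?Y0 ?Y1 ?Y2 ?Y3.
- by have [-> _ _ _] := eX f; rewrite addr0.
- have [-> _ _ _] := eX (M f); have [_ -> _ _] := eX f; ring.
- have [-> _ _ _] := eX (M (M f) / 2%:R); have [_ -> _ _] := eX (M f).
  by have [_ _ -> _] := eX f; rewrite raddfD MD !LM; field.
have [-> _ _ _] := eX (M (M (M f)) / 6%:R); have [_ -> _ _] := eX (M (M f) / 2%:R).
have [_ _ -> _] := eX (M f); have [_ _ _ ->] := eX f.
by rewrite half !(raddfD, MD) !LM; field; rewrite six_neq0.
Qed.

(* w = coth(u/2) if x/y = exp(u); the coefficients are those of
   b h + log(cosh(b h) + w sinh(b h)). *)
Lemma exp3_factor (x y b : A) (t : nat -> A) : x - y != 0 -> exp3 t (2%:R * b) 0 0 ->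
  let w := (x + y) / (x - y) in
  exp3 (smul (sadd (smul t (sconst x)) (sconst (- y))) (sconst (x - y)^-1))
    (b * (1 + w)) (b ^+ 2 * (1 - w ^+ 2) / 2%:R) (b ^+ 3 * (w ^+ 3 - w) / 3%:R).
Proof.
move=> xy [t0 t1 t2 t3] /=.
split; rewrite /smul /sadd /sconst !(big_ord_recl, big_ord0) /= ?subSS ?subn0 /bump /=
  ?t0 ?t1 ?t2 ?t3.
- by field.
- by field.
- by field; rewrite two_neq0 xy.
- by field; rewrite six_neq0 two_neq0 three_neq0 xy.
Qed.

Lemma opscale_sum (J : finType) (Q : pred J) s (Y : J -> opseries A) k f :
  opscale s (fun l g => \sum_(I | Q I) Y I l g) k f = \sum_(I | Q I) opscale s (Y I) k f.
Proof. by rewrite /opscale exchange_big; apply: eq_bigr => l _; rewrite mulr_sumr. Qed.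

(** The exponent of [s] is split so that [e1] and [e2] can collect what is the same for all subsets
    I. Then 1, [c1], [c2], [c3] are the coefficients of exp((g + e1) h + e2 h^2), and [f], [f1],
    [f2], [f3] those of exp(a1 h + a2 h^2 + a3 h^3) exp(h L) applied to [f]. *)
Lemma opscale_exp3 p s X L g e1 e2 a1 a2 a3 f :
  exp3 p g 0 0 -> exp3 s (e1 + a1) (e2 + a2) a3 -> opexp3 X L ->
  let c1 := g + e1 in let c2 := e2 + c1 ^+ 2 / 2%:R in
  let c3 := c1 * e2 + c1 ^+ 3 / 6%:R in
  let f1 := a1 * f + L f in
  let f2 := (a2 + a1 ^+ 2 / 2%:R) * f + a1 * L f + L (L f) / 2%:R in
  let f3 := (a3 + a1 * a2 + a1 ^+ 3 / 6%:R) * f + (a2 + a1 ^+ 2 / 2%:R) * L f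
    + a1 * (L (L f) / 2%:R) + L (L (L f)) / 6%:R in
  [/\ opscale p (opscale s X) 0%N f = f, opscale p (opscale s X) 1%N f = f1 + c1 * f,
      opscale p (opscale s X) 2%N f = f2 + c1 * f1 + c2 * f
    & opscale p (opscale s X) 3%N f = f3 + c1 * f2 + c2 * f1 + c3 * f].
Proof.
move=> [p0 p1 p2 p3] [s0 s1 s2 s3] /(_ f)[x0 x1 x2 x3] /=.
split; rewrite /opscale !(big_ord_recl, big_ord0) /= ?subSS ?subn0 /bump /=
  ?p0 ?p1 ?p2 ?p3 ?s0 ?s1 ?s2 ?s3 ?x0 ?x1 ?x2 ?x3.
- by ring.
- by ring.
- by field.
- by field; rewrite six_neq0.
Qed.

End CubicTruncation.

(** * Sums over subsets of given cardinality *)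

Section SubsetSums.
Variables (F : fieldType) (T : finType) (r : nat).
Implicit Types (A I : {set T}).

(** The number of r-subsets containing k given points. The test is needed because for k > r the
    truncated difference r - k is 0 and the binomial would be 1. *)
Definition supersets k : nat := if (k <= r)%N then 'C(#|T| - k, r - k) else 0.

(** Adding A is a bijection from the subsets of the complement of A with r - #|A| elements onto the
    r-subsets containing A. *)
Lemma card_supersets A :
  #|[set I : {set T} | (A \subset I) && (#|I| == r)]| = supersets #|A|.
Proof.
rewrite /supersets; case: leqP => [Ar|rA]; last first.
  apply/eqP; rewrite cards_eq0; apply/eqP/setP => I; rewrite !inE.
  apply/negP => /andP[/subset_leq_card AI /eqP Ir].
  by move: AI; rewrite Ir leqNgt rA.
have <- : #|~: A| = (#|T| - #|A|)%N by rewrite cardsCs setCK.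
rewrite -cards_draws -[RHS](card_in_imset (f := setU A)); last first.
  move=> B C; rewrite !inE -!disjoints_subset => /andP[BA _] /andP[CA _] e.
  apply/setP => x; have /setP/(_ x) := e; rewrite !inE.
  case xA: (x \in A) => //=.
  by rewrite (disjointFl BA xA) (disjointFl CA xA).
congr #|pred_of_set _|; apply/setP => I; rewrite inE; apply/andP/imsetP => [[AI /eqP Ir]|[B]].
  exists (I :\: A); last first.
    by rewrite setUC setDE setUIl [~: A :|: A]setUC setUCr setIT; apply/esym/setUidPl.
  by rewrite inE cardsD (setIidPr AI) Ir eqxx andbT setDE subsetIr.
rewrite inE -disjoints_subset => /andP[BA /eqP Br] ->; rewrite subsetUl; split=> //.
by rewrite cardsU setIC (eqP (_ : B :&: A == set0)) ?setI_eq0 // cards0 subn0 Br subnKC.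
Qed.

Local Notation m k := ((supersets k)%:R : F).

Lemma sum_mem3 i j k : \sum_(I : {set T} | #|I| == r)
   ((i \in I)%:R * ((j \in I)%:R * (k \in I)%:R)) = m #|[set i; j; k]| :> F.
Proof.
rewrite -card_supersets -sum1_card natr_sum [LHS]big_mkcond [RHS]big_mkcond /=.
apply: eq_bigr => I _; rewrite inE !subUset !sub1set.
by case: (i \in I); case: (j \in I); case: (k \in I); case: (#|I| == r); rewrite /= ?mul1r ?mul0r.
Qed.

(** Interpolation in the number of coincidences: with no equality the value is m 3, with exactly one
    it is m 3 + (m 2 - m 3), and with all three the last coefficient corrects m 3 + 3 (m 2 - m 3) to
    m 1. *)
Lemma supersets3 (i j k : T) : m #|[set i; j; k]| = m 3 +
  (m 2 - m 3) * ((i == j)%:R + (i == k)%:R + (j == k)%:R)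
  + (m 1 - 3%:R * m 2 + 2%:R * m 3) * ((i == j)%:R * (j == k)%:R).
Proof.
rewrite setUC !cardsU1 !inE cards1 ![k == _]eq_sym.
have [->|ij] := eqVneq i j; have [jk|jk] := eqVneq j k; rewrite ?eqxx /=; try by ring.
  by rewrite -jk (negPf ij) /=; ring.
by case: (i == k) => /=; ring.
Qed.

Lemma sum_mem (g : T -> F) I : \sum_(i in I) g i = \sum_i (i \in I)%:R * g i.
Proof. by rewrite big_mkcond; apply: eq_bigr => i _; case: (i \in I); rewrite ?mul1r ?mul0r. Qed.

Lemma sum_delta (g : T -> F) i : \sum_k (i == k)%:R * g k = g i.
Proof.
rewrite (bigD1 i) //= eqxx mul1r big1 ?addr0 // => k.
by rewrite eq_sym => /negPf->; rewrite mul0r.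
Qed.

Lemma sum_subsets2 (g : T -> T -> F) :
  \sum_(I : {set T} | #|I| == r) \sum_(i in I) \sum_(j in I) g i j
  = m 2 * (\sum_i \sum_j g i j) + (m 1 - m 2) * \sum_i g i i.
Proof.
(* The point j is repeated so that the count for three points also serves for two. *)
transitivity (\sum_i \sum_j m #|[set i; j; j]| * g i j).
  under eq_bigr => I _.
    rewrite sum_mem; under eq_bigr => i _ do rewrite sum_mem mulr_sumr.
    over.
  rewrite exchange_big; apply: eq_bigr => i _.
  rewrite exchange_big; apply: eq_bigr => j _.
  rewrite -sum_mem3 mulr_suml; apply: eq_bigr => I _.
  by case: (j \in I) => /=; ring.
rewrite !mulr_sumr -big_split /=; apply: eq_bigr => i _.
rewrite -[g i i](sum_delta (fun j => g i j)) !mulr_sumr -big_split /=.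
by apply: eq_bigr => j _; rewrite supersets3 eqxx /=; ring.
Qed.

Lemma sum_subsets1 (g : T -> F) :
  \sum_(I : {set T} | #|I| == r) \sum_(i in I) g i = m 1 * \sum_i g i.
Proof.
under eq_bigr => I _ do rewrite sum_mem.
rewrite exchange_big mulr_sumr; apply: eq_bigr => i _.
rewrite -mulr_suml; congr (_ * _); have <- : #|[set i; i; i]| = 1%N by rewrite !setUid cards1.
rewrite -sum_mem3; apply: eq_bigr => I _.
by case: (i \in I) => /=; ring.
Qed.

(** Written with indicator functions, the sum over I turns into the weight m #|{i, j, k}|, whose
    expansion in Kronecker deltas yields the full sum and the sums over the diagonals. *)
Lemma sum_subsets3 (g : T -> T -> T -> F) :
  \sum_(I : {set T} | #|I| == r) \sum_(i in I) \sum_(j in I) \sum_(k in I) g i j k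
  = m 3 * (\sum_i \sum_j \sum_k g i j k)
  + (m 2 - m 3) * (\sum_i \sum_k (g i i k + g i k i + g k i i))
  + (m 1 - 3%:R * m 2 + 2%:R * m 3) * (\sum_i g i i i).
Proof.
transitivity (\sum_i \sum_j \sum_k m #|[set i; j; k]| * g i j k).
  under eq_bigr => I _.
    rewrite sum_mem; under eq_bigr => i _.
      rewrite sum_mem mulr_sumr; under eq_bigr => j _.
        rewrite sum_mem !mulr_sumr; over.
      over.
    over.
  rewrite exchange_big; apply: eq_bigr => i _.
  rewrite exchange_big; apply: eq_bigr => j _.
  rewrite exchange_big; apply: eq_bigr => k _.
  by rewrite -sum_mem3 mulr_suml; apply: eq_bigr => I _; ring.
(* The diagonal sums are written as triple sums with deltas, so that [supersets3] can be applied
   term by term. *)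
have -> : \sum_i \sum_k (g i i k + g i k i + g k i i) = 
   \sum_i \sum_j \sum_k ((i == j)%:R * g i j k + (i == k)%:R * g i j k + (j == k)%:R * g i j k).
  have e1 : \sum_i \sum_j \sum_k (i == j)%:R * g i j k = \sum_i \sum_k g i i k.
    apply: eq_bigr => i _; rewrite exchange_big; apply: eq_bigr => k _; exact: sum_delta.
  have e2 : \sum_i \sum_j \sum_k (i == k)%:R * g i j k = \sum_i \sum_k g i k i.
    apply: eq_bigr => i _; apply: eq_bigr => k _; exact: (sum_delta (fun l => g i k l)).
  have e3 : \sum_i \sum_j \sum_k (j == k)%:R * g i j k = \sum_i \sum_k g k i i.
    rewrite [RHS]exchange_big.
    apply: eq_bigr => i _; apply: eq_bigr => j _; exact: (sum_delta (fun l => g i j l)).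
  under eq_bigr => i _ do rewrite !big_split /=.
  rewrite !big_split /= -e1 -e2 -e3 -!big_split /=; apply: eq_bigr => i _.
  by rewrite -!big_split /=; apply: eq_bigr => j _; rewrite -!big_split.
have -> : \sum_i g i i i = \sum_i \sum_j \sum_k (i == j)%:R * (j == k)%:R * g i j k.
  apply: eq_bigr => i _; rewrite -[LHS](sum_delta (fun j => g i j j)); apply: eq_bigr => j _.
  by rewrite -(sum_delta (fun k => g i j k)) mulr_sumr; apply: eq_bigr => k _; ring.
rewrite !mulr_sumr -!big_split /=; apply: eq_bigr => i _.
rewrite !mulr_sumr -!big_split /=; apply: eq_bigr => j _.
rewrite !mulr_sumr -!big_split /=; apply: eq_bigr => k _.
by rewrite supersets3; ring.
Qed.

End SubsetSums.

(** * The Lax pair *)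

Section Lax.
Variables (F : fieldType) (T : finType) (D : T -> {additive F -> F}).
Variables (w : T -> T -> F) (b : F).
Hypothesis two_neq0 : 2%:R != 0 :> F.
Hypothesis three_neq0 : 3%:R != 0 :> F.
Hypothesis DM : forall i x y, D i (x * y) = D i x * y + x * D i y.
Hypothesis DC : forall i j x, D i (D j x) = D j (D i x).
Hypothesis Db : forall i, D i b = 0.
Hypothesis w_anti : forall i j, w j i = - w i j.
Hypothesis w_triple : forall i j k, i != j -> j != k -> i != k ->
  w i j * w j k + w j k * w k i + w k i * w i j = -1.
(** The logarithmic derivative of w_ij in x_i. The diagonal is set to 0 by hand: there w vanishes
    and the formula would give 1/2. *)
Let v i j := if i == j then 0 else (1 - w i j ^+ 2) / 2%:R.
Hypothesis Dw : forall k i j,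
  D k (w i j) = v i j * ((k == i)%:R - (k == j)%:R).

(** The Lax matrix acting on vectors of functions: its diagonal entries are D_i + b sum_j w_ij, the
    others - b w_ij. On constant vectors the terms in b drop out. *)
Definition lax (phi : T -> F) i : F :=
  D i (phi i) + b * \sum_j w i j * (phi i - phi j).
Definition wsum i := \sum_j w i j.
Definition wsqsum i := \sum_j w i j ^+ 2.
(** The Calogero-Sutherland Hamiltonian H in the gauge whose eigenfunctions are the Jack
    polynomials. *)
Definition laplace (f : F) : F :=
  \sum_k D k (D k f) + 2%:R * b * \sum_k wsum k * D k f.
(* H - M in the Lax equation [H - M, L] = 0. *)
Definition lax_flow (phi : T -> F) i : F :=
  laplace (phi i) + 2%:R * b * \sum_j v i j * (phi i - phi j).

Lemma w_diag i : w i i = 0.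
Proof.
apply/eqP; have /eqP := w_anti i i.
by rewrite -addr_eq0 -mulr2n -mulr_natl mulf_eq0 (negPf two_neq0).
Qed.

Lemma v_sym i j : v j i = v i j.
Proof. by rewrite /v eq_sym w_anti sqrrN. Qed.

Lemma v_diag i : v i i = 0.
Proof. by rewrite /v eqxx. Qed.

Lemma D_const_scale i c x : D i c = 0 -> D i (c * x) = c * D i x.
Proof. by move=> Dc; rewrite DM Dc mul0r add0r. Qed.

Lemma D_natr i m : D i m%:R = 0.
Proof.
rewrite raddfMn; have := DM i 1 1; rewrite !mul1r mulr1 -{1}[D i 1]addr0.
by move=> /addrI <-; rewrite mul0rn.
Qed.

Lemma D2b i : D i (2%:R * b) = 0.
Proof. by rewrite DM D_natr Db mul0r mulr0 addr0. Qed.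

Lemma sum_antisym (P : pred T) (g : T -> T -> F) :
  (forall i j, g j i = - g i j) -> \sum_(i | P i) \sum_(j | P j) g i j = 0.
Proof.
move=> ganti; set S := LHS; apply/eqP.
have : S = - S.
  rewrite {1}/S exchange_big /= -sumrN; apply: eq_bigr => i _.
  by rewrite -sumrN; apply: eq_bigr => j _.
by move/eqP; rewrite -addr_eq0 -mulr2n -mulr_natl mulf_eq0 (negPf two_neq0).
Qed.

Lemma sum_wdelta (g : T -> F) i j :
  \sum_k g k * D k (w i j) = v i j * (g i - g j).
Proof.
under eq_bigr => k _ do rewrite Dw.
have d (l : T) : \sum_k g k * (v i j * (k == l)%:R) = g l * v i j.
  rewrite (bigD1 l) //= eqxx mulr1 big1 ?addr0 // => k /negPf->.
  by rewrite mulr0 mulr0.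
under eq_bigr => k _ do rewrite mulrBr mulrBr.
by rewrite big_split /= sumrN !d; ring.
Qed.

Lemma Dv k i j : D k (v i j) = - w i j * D k (w i j).
Proof.
rewrite /v; case: eqP => [->|_]; first by rewrite w_diag mulNr mul0r oppr0 raddf0.
apply: (mulfI two_neq0); rewrite -(D_const_scale _ (D_natr k 2)) mulrCA divff // mulr1.
by rewrite raddfB /= (D_natr k 1) expr2 DM; ring.
Qed.

Lemma Dv1 i j : D i (v i j) = - w i j * v i j.
Proof.
rewrite Dv Dw eqxx; case: eqP => [->|_]; last by rewrite subr0 mulr1.
by rewrite v_diag !mul0r.
Qed.

(** * The Lax equation *)

Lemma laplaceD x y : laplace (x + y) = laplace x + laplace y.
Proof.
rewrite /laplace; under eq_bigr => k _ do rewrite !raddfD.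
under [X in _ + _ * X]eq_bigr => k _ do rewrite raddfD mulrDr.
by rewrite !big_split /=; ring.
Qed.

Lemma laplaceB x y : laplace (x - y) = laplace x - laplace y.
Proof. by apply: (canRL (addrK _)); rewrite -laplaceD subrK. Qed.

Lemma laplaceM x y :
  laplace (x * y) = laplace x * y + x * laplace y + 2%:R * \sum_k D k x * D k y.
Proof.
rewrite /laplace.
have -> : \sum_k D k (D k (x * y)) = (\sum_k D k (D k x)) * y + x * (\sum_k D k (D k y))
    + 2%:R * \sum_k D k x * D k y.
  rewrite mulr_suml !mulr_sumr -!big_split /=; apply: eq_bigr => k _.
  by rewrite DM raddfD !DM; ring.
have -> : \sum_k wsum k * D k (x * y) = (\sum_k wsum k * D k x) * y + x * (\sum_k wsum k * D k y).
  rewrite mulr_suml mulr_sumr -big_split /=; apply: eq_bigr => k _.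
  by rewrite DM; ring.
by ring.
Qed.

Lemma laplace_const_scale c x : (forall i, D i c = 0) -> laplace (c * x) = c * laplace x.
Proof.
move=> Dc; rewrite laplaceM [X in _ + _ * X]big1 => [|k _]; last by rewrite Dc mul0r.
rewrite /laplace [X in (X + _) * x]big1 => [|k _]; last by rewrite Dc raddf0.
by rewrite [X in (_ + _ * X) * x]big1 => [|k _]; [ring | rewrite Dc mulr0].
Qed.

Lemma laplace_w i j :
  laplace (w i j) = 2%:R * (- w i j * v i j + b * v i j * (wsum i - wsum j)).
Proof.
rewrite /laplace sum_wdelta.
have -> : \sum_k D k (D k (w i j)) = - 2%:R * w i j * v i j.
  have [->|ij] := eqVneq i j.
    by rewrite v_diag mulr0 big1 // => k _; rewrite Dw v_diag mul0r raddf0.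
  have -> : \sum_k D k (D k (w i j)) = \sum_k (- w i j * ((k == i)%:R - (k == j)%:R)) * D k (w i j).
    apply: eq_bigr => k _; rewrite {1}Dw.
    by rewrite DM raddfB /= !D_natr Dv; ring.
  by rewrite sum_wdelta !eqxx [j == i]eq_sym (negPf ij) /=; ring.
by ring.
Qed.

Lemma D_wsum i k : D i (wsum k) = \sum_l D i (w k l).
Proof. exact: raddf_sum. Qed.

(** The D_k commute among themselves, so the commutator of D_i with H comes only from
    differentiating the coefficients [wsum k]. *)
Lemma D_laplace i x :
  D i (laplace x) = laplace (D i x) + 2%:R * b * \sum_j v i j * (D i x - D j x).
Proof.
rewrite /laplace raddfD /= raddf_sum -addrA; congr (_ + _).
  by apply: eq_bigr => k _; rewrite !(DC i k).
rewrite (D_const_scale _ (D2b i)) -mulrDr; congr (_ * _).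
rewrite raddf_sum /=.
under eq_bigr => k _ do rewrite DM (DC i k).
rewrite big_split /= addrC; congr (_ + _).
under eq_bigr => k _.
  rewrite D_wsum mulr_suml.
  under eq_bigr => l _ do rewrite Dw mulrBr mulrBl.
  rewrite big_split /= sumrN.
  over.
rewrite big_split /= sumrN.
have -> : \sum_k \sum_l v k l * (i == k)%:R * D k x = \sum_l v i l * D i x.
  rewrite -[RHS](sum_delta (fun k => \sum_l v k l * D k x)); apply: eq_bigr => k _.
  by rewrite mulr_sumr; apply: eq_bigr => l _; ring.
have -> : \sum_k \sum_l v k l * (i == l)%:R * D k x = \sum_k v i k * D k x.
  apply: eq_bigr => k _; rewrite -v_sym -(sum_delta (fun l => v k l * D k x)).
  by apply: eq_bigr => l _; ring.
by rewrite -sumrB; apply: eq_bigr => j _; ring.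
Qed.

(* The double sum over j and k of which this is made vanishes because w_triple
   makes its terms with i, j, k distinct antisymmetric in j and k. *)
Lemma triple_sum (phi : T -> F) i :
  \sum_j (v i j * (wsum i - wsum j) * (phi i - phi j)
    + v i j * (\sum_k w i k * (phi i - phi k) - \sum_k w j k * (phi j - phi k))
    - w i j * (\sum_k v i k * (phi i - phi k) - \sum_k v j k * (phi j - phi k))) = 0.
Proof.
(* The summand, with j and k exchanged in the single term w_ij v_ik (phi_i - phi_k); the double sum
   is unchanged. *)
pose t j k := v i j * (w i k - w j k) * (phi i - phi j) + v i j * w i k * (phi i - phi k)
  - v i j * w j k * (phi j - phi k) - w i k * v i j * (phi i - phi j)
  + w i j * v j k * (phi j - phi k).
transitivity (\sum_j \sum_k t j k).
  have -> : \sum_j \sum_k t j k = \sum_j (\sum_k (t j k + w i k * v i j * (phi i - phi j)))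
      - \sum_j \sum_k w i j * v i k * (phi i - phi k).
    rewrite [X in _ - X]exchange_big -sumrB; apply: eq_bigr => j _.
    by rewrite -sumrB; apply: eq_bigr => k _; ring.
  rewrite -sumrB; apply: eq_bigr => j _.
  rewrite /wsum -!sumrB !mulr_sumr mulr_suml -big_split -sumrB /=.
  by apply: eq_bigr => k _; rewrite /t; ring.
(* The row j = i of [t] vanishes, and for j != i the terms k = i and k = j cancel each other. *)
pose t' j k := if [&& i != j, j != k & i != k] then t j k else 0.
have -> : \sum_j \sum_k t j k = \sum_j \sum_k t' j k.
  apply: eq_bigr => j _.
  have [<-|ij] := eqVneq i j.
    rewrite !big1 // => k _; rewrite /t' ?eqxx // /t v_diag w_diag; ring.
  rewrite (bigD1 i) // [RHS](bigD1 i) //= (bigD1 j) 1?eq_sym //= [in RHS](bigD1 j) 1?eq_sym //=.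
  rewrite !addrA; congr (_ + _); last first.
    by apply: eq_bigr => k /andP[ki kj]; rewrite /t' ij eq_sym kj eq_sym ki.
  by rewrite /t' !eqxx !andbF addr0 /t !v_diag !w_diag w_anti (v_sym i j); ring.
apply: sum_antisym => j k.
have -> : t' k j = if [&& i != j, j != k & i != k] then t k j else 0.
  by rewrite /t' [k == j]eq_sym; do 3!case: (_ == _).
rewrite /t'; case: ifP => [/and3P[ij jk ik]|]; last by rewrite oppr0.
have q0 : 1 + (w i j * w j k - w j k * w i k - w i k * w i j) = 0.
  by rewrite -(addrN 1) -(w_triple ij jk ik) (w_anti i k); ring.
apply/eqP; rewrite -addr_eq0; apply/eqP.
(* The symmetric part of [t] contains the relation [w_triple] as a factor. *)
have -> : t k j + t j k = (1 + (w i j * w j k - w j k * w i k - w i k * w i j))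
    * ((w i j + w i k) * (phi i - phi k) - (w i k + w j k) * (phi j - phi k)) / 2%:R.
  rewrite /t /v (negPf ij) (negPf ik) (negPf jk) eq_sym (negPf jk) (w_anti j k).
  by field.
by rewrite q0 !mul0r.
Qed.

Lemma laplace_sum (g : T -> F) : laplace (\sum_j g j) = \sum_j laplace (g j).
Proof.
apply: (big_morph laplace laplaceD).
by rewrite -[in LHS](subrr 0) laplaceB subrr.
Qed.

(** The Lax equation. After expansion all terms containing derivatives of [phi] cancel, and so do
    the remaining ones except for a multiple of [triple_sum]. *)
Lemma lax_flow_comm phi i : lax_flow (lax phi) i = lax (lax_flow phi) i.
Proof.
rewrite /lax_flow {1 4}/lax.
rewrite laplaceD raddfD /= D_laplace (laplace_const_scale _ Db) laplace_sum.
rewrite (D_const_scale _ (D2b i)) raddf_sum /=.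
have lapwM j : laplace (w i j * (phi i - phi j)) =
    2%:R * (- w i j * v i j + b * v i j * (wsum i - wsum j)) * (phi i - phi j)
    + w i j * (laplace (phi i) - laplace (phi j))
    + 2%:R * v i j * ((D i (phi i) - D i (phi j)) - (D j (phi i) - D j (phi j))).
  rewrite laplaceM laplace_w laplaceB.
  under eq_bigr => k _ do rewrite mulrC.
  by rewrite sum_wdelta !raddfB /=; ring.
have DvM j : D i (v i j * (phi i - phi j)) =
    - w i j * v i j * (phi i - phi j) + v i j * (D i (phi i) - D i (phi j)).
  by rewrite DM Dv1 raddfB.
under eq_bigr => j _ do rewrite lapwM.
under [X in _ = _ + _ * X + _]eq_bigr => j _ do rewrite DvM.
(* Both sides share the term [l]; every other term has a factor b, which is taken out. *)
have combine (l s1 s2 s3 s4 s5 : F) : s1 + 2%:R * s2 - 2%:R * s3 - 2%:R * s4 - s5 = 0 ->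
    l + b * s1 + 2%:R * b * s2 = l + 2%:R * b * s3 + 2%:R * b * s4 + b * s5.
  move=> h; apply/eqP; rewrite -subr_eq0; apply/eqP.
  by rewrite -[RHS](mulr0 b) -h; ring.
apply: combine.
have := congr1 (fun x => 2%:R * b * x) (triple_sum phi i); rewrite mulr0; apply: etrans.
rewrite !mulr_sumr -!big_split -!sumrB /=.
by apply: eq_bigr => j _; rewrite /lax -mulr_sumr; ring.
Qed.

(** The symmetry of v makes the columns of M sum to zero. *)
Lemma sum_lax_flow phi : \sum_i lax_flow phi i = laplace (\sum_i phi i).
Proof.
rewrite laplace_sum big_split /= -mulr_sumr sum_antisym ?mulr0 ?addr0 // => i j.
by rewrite v_sym; ring.
Qed.

Lemma lax_flow_const f i : lax_flow (fun=> f) i = laplace f.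
Proof. by rewrite /lax_flow big1 ?mulr0 ?addr0 // => j _; rewrite subrr mulr0. Qed.

Lemma eq_lax phi psi : phi =1 psi -> lax phi =1 lax psi.
Proof.
move=> e i; rewrite /lax e; congr (_ + _ * _).
by apply: eq_bigr => j _; rewrite e.
Qed.

(** The sum of all entries of L^k, as an operator; it is not the matrix trace. *)
Definition lax_trace k (f : F) := \sum_i iter k lax (fun=> f) i.

(** The flow H - M acts as H on constant vectors and also after summing the entries; in between it
    commutes with L. *)
Lemma laplace_lax_trace k f : laplace (lax_trace k f) = lax_trace k (laplace f).
Proof.
rewrite /lax_trace -sum_lax_flow; apply: eq_bigr => i _.
elim: k i => [|k IHk] i /=; first exact: lax_flow_const.
by rewrite lax_flow_comm; apply: eq_lax.
Qed.

(** * Identities for the row sums of w *)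

(** Summation of [w_triple] over i and k for fixed j: for distinct indices [s i k + s k i] = -2, so
    [s + 1] is antisymmetric and each of the (N - 1)(N - 2) ordered pairs contributes -1 on average,
    where N = #|T|. *)
Lemma sum_w_wsum j : 2%:R * \sum_i w j i * wsum i =
  wsum j ^+ 2 - 3%:R * wsqsum j - (#|T|.-1 * #|T|.-2)%:R.
Proof.
pose s i k := 2%:R * w j i * w i k - w j i * w j k.
pose s' i k := if [&& i != j, k != j & i != k] then s i k + 1 else 0.
have s'0 : \sum_i \sum_k s' i k = 0.
  apply: sum_antisym => i k.
  have -> : s' k i = if [&& i != j, k != j & i != k] then s k i + 1 else 0.
    by rewrite /s' [k == i]eq_sym; do 3!case: (_ == _).
  rewrite /s'; case: ifP => [/and3P[ij kj ik]|]; last by rewrite oppr0.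
  rewrite eq_sym in ij; have := w_triple ij ik; rewrite eq_sym => /(_ kj) tr.
  apply/eqP; rewrite -addr_eq0 /s (w_anti i k) (w_anti j k) in tr *; apply/eqP.
  have -> : 2%:R * w j k * - w i k - w j k * w j i + 1
    + (2%:R * w j i * w i k - w j i * w j k + 1)
    = 2%:R * (w j i * w i k + w i k * - w j k + - w j k * w j i - -1) by ring.
  by rewrite tr subrr mulr0.
(* The exceptional indices k = i and k = j contribute - w_ji^2 and - 2 w_ji^2. *)
have row i : i != j -> \sum_k s i k = \sum_k s' i k - 3%:R * w j i ^+ 2 - (#|T|.-2)%:R.
  move=> ij.
  rewrite (bigD1 i) // (bigD1 j) 1?eq_sym //= [in RHS](bigD1 i) //= [in RHS](bigD1 j) 1?eq_sym //=.
  have -> : \sum_(k | (k != i) && (k != j)) s' i k =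
      \sum_(k | (k != i) && (k != j)) s i k + (#|T|.-2)%:R.
    have -> : #|T|.-2 = (\sum_(k | (k != i) && (k != j)) 1)%N.
      rewrite sum1_card -(cardC (pred2 i j)) card2 ij.
      by apply: eq_card => k; rewrite !inE negb_or.
    rewrite natr_sum.
    rewrite -big_split /=; apply: eq_bigr => k /andP[ki kj].
    by rewrite /s' ij kj eq_sym ki.
  by rewrite /s' !eqxx !andbF /s !w_diag (w_anti j i); ring.
have sj k : s j k = 0 by rewrite /s w_diag; ring.
have : \sum_i \sum_k s i k = - 3%:R * wsqsum j - (#|T|.-1 * #|T|.-2)%:R.
  rewrite (bigD1 j) //= big1 // add0r.
  rewrite (eq_bigr _ row) !big_split /= !sumrN -mulr_sumr sumr_const cardC1 -mulrnA mulnC.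
  move: s'0; rewrite (bigD1 j) //= big1 => [|k _]; last by rewrite /s' eqxx.
  by rewrite /wsqsum [X in _ = _ * X - _](bigD1 j) //= w_diag !add0r => ->; ring.
have -> : \sum_i \sum_k s i k = 2%:R * (\sum_i w j i * wsum i) - wsum j ^+ 2.
  rewrite expr2 {2}/wsum mulr_suml mulr_sumr -sumrB; apply: eq_bigr => i _.
  rewrite -[w j i * wsum j]mulr1 /wsum !mulr_sumr !mulr_suml -sumrB.
  by apply: eq_bigr => k _; rewrite /s; ring.
by move=> e; rewrite -[LHS](subrK (wsum j ^+ 2)) e; ring.
Qed.

Lemma sum_wsum : \sum_i wsum i = 0.
Proof. exact: sum_antisym. Qed.

(** Summing [sum_w_wsum] over j turns its left side into -2 sum_i W_i^2 by antisymmetry. Hence a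
    scalar that occurs in the coefficients of h^2 and h^3 is constant. *)
Lemma sum_wsum_wsqsum :
  3%:R * \sum_i (wsum i ^+ 2 - wsqsum i) = (#|T| * (#|T|.-1 * #|T|.-2))%:R.
Proof.
have e : \sum_j 2%:R * (\sum_i w j i * wsum i) = - 2%:R * \sum_i wsum i ^+ 2.
  rewrite -mulr_sumr exchange_big /= mulNr -mulrN -sumrN; congr (_ * _).
  apply: eq_bigr => i _; rewrite -mulr_suml expr2 -mulNr; congr (_ * _).
  by rewrite -sumrN; apply: eq_bigr => j _.
have := e; under eq_bigr => j _ do rewrite sum_w_wsum.
rewrite !sumrB -mulr_sumr sumr_const (_ : #|xpredT| = #|T|); last exact: eq_card.
set m := (_.-1 * _)%N => {}e; rewrite natrM [RHS]mulr_natl; set c := m%:R *+ _ in e *.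
have -> : c = \sum_i wsum i ^+ 2 - 3%:R * \sum_i wsqsum i + 2%:R * \sum_i wsum i ^+ 2.
  by rewrite -[LHS](subKr (\sum_i wsum i ^+ 2 - 3%:R * \sum_i wsqsum i)) e; ring.
by ring.
Qed.

(** [sum_w_wsum] is multiplied by W_j and summed: the left side vanishes by antisymmetry, the
    constant term because the W_j sum to 0. *)
Lemma sum_wsum3 : \sum_i (wsum i ^+ 3 - 3%:R * (wsqsum i * wsum i)) = 0.
Proof.
have : \sum_i wsum i * (2%:R * \sum_j w i j * wsum j) = 0.
  under eq_bigr => i _ do rewrite !mulr_sumr.
  by apply: sum_antisym => i j; rewrite w_anti; ring.
under eq_bigr => i _ do rewrite sum_w_wsum !mulrBr.
rewrite sumrB -mulr_suml sum_wsum mul0r subr0 => e; rewrite -[RHS]e.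
by apply: eq_bigr => i _; ring.
Qed.

(** * The operators H and H_3 in explicit form *)

Lemma sum_lax phi : \sum_i lax phi i = \sum_i D i (phi i) + 2%:R * b * \sum_i wsum i * phi i.
Proof.
rewrite big_split /= -mulr_sumr [2%:R * b]mulrC -mulrA; congr (_ + b * _).
have -> : \sum_i \sum_j w i j * (phi i - phi j) =
    \sum_i \sum_j w i j * phi i - \sum_i \sum_j w i j * phi j.
  rewrite -sumrB; apply: eq_bigr => i _; rewrite -sumrB.
  by apply: eq_bigr => j _; rewrite mulrBr.
rewrite [X in _ - X]exchange_big /= -sumrB mulr_sumr; apply: eq_bigr => i _.
rewrite -sumrB /wsum mulr_suml mulr_sumr; apply: eq_bigr => j _.
by rewrite w_anti; ring.
Qed.

Definition D_total (f : F) := \sum_i D i f.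

Lemma lax1 f i : lax (fun=> f) i = D i f.
Proof. by rewrite /lax big1 ?mulr0 ?addr0 // => j _; rewrite subrr mulr0. Qed.

Lemma lax2 f i : lax (lax (fun=> f)) i =
  D i (D i f) + b * \sum_j w i j * (D i f - D j f).
Proof. by rewrite (eq_lax (lax1 f)). Qed.

Lemma lax_trace2 f : lax_trace 2 f = laplace f.
Proof.
by rewrite /lax_trace /= sum_lax /laplace; congr (_ + _ * _);
   apply: eq_bigr => i _; rewrite lax1.
Qed.

Lemma lax_trace3 f : lax_trace 3 f = \sum_i D i (D i (D i f))
  + 3%:R * b * \sum_i wsum i * D i (D i f)
  + 3%:R * b ^+ 2 * \sum_i (wsum i ^+ 2 - wsqsum i) * D i f
  - b ^+ 2 * (#|T|.-1 * #|T|.-2)%:R * D_total f.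
Proof.
rewrite /lax_trace /= sum_lax.
under [X in _ + 2%:R * b * X = _]eq_bigr => i _ do rewrite lax2 mulrDr.
under [X in X + _ = _]eq_bigr => i _ do
  rewrite lax2 raddfD /= (D_const_scale _ (Db i)) raddf_sum /=.
rewrite big_split /= -mulr_sumr [X in _ + 2%:R * b * X = _]big_split /=.
(* The terms v_ij (D_i f - D_j f) and w_ij D_i D_j f are antisymmetric in i and j and drop out. *)
have -> : \sum_i \sum_j D i (w i j * (D i f - D j f)) = \sum_i wsum i * D i (D i f).
  transitivity (\sum_i wsum i * D i (D i f)
      + \sum_i \sum_j (v i j * (D i f - D j f) - w i j * D i (D j f))).
    rewrite -big_split /=; apply: eq_bigr => i _; rewrite /wsum mulr_suml -big_split /=.
    apply: eq_bigr => j _; rewrite DM raddfB /= Dw eqxx.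
    by case: eqP => [->|_]; rewrite ?v_diag ?w_diag /=; ring.
  by rewrite [X in _ + X]sum_antisym ?addr0 // => i j; rewrite v_sym w_anti (DC j i); ring.
have -> : \sum_i wsum i * (b * \sum_j w i j * (D i f - D j f)) =
    b * \sum_i (wsum i ^+ 2 + \sum_j w i j * wsum j) * D i f.
  have -> : \sum_i wsum i * (b * \sum_j w i j * (D i f - D j f)) =
      b * (\sum_i \sum_j wsum i * w i j * D i f - \sum_i \sum_j wsum i * w i j * D j f).
    rewrite -sumrB mulr_sumr; apply: eq_bigr => i _; rewrite mulrCA mulr_sumr -sumrB.
    by congr (_ * _); apply: eq_bigr => j _; ring.
  rewrite [X in _ - X]exchange_big /= -sumrB; congr (_ * _); apply: eq_bigr => i _.
  rewrite -mulr_suml -mulr_suml -mulr_sumr -mulrBl -/(wsum i) expr2; congr (_ * _).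
  by rewrite -sumrN; congr (_ + _); apply: eq_bigr => j _; rewrite w_anti; ring.
have -> : 2%:R * b * (\sum_i wsum i * D i (D i f)
      + b * \sum_i (wsum i ^+ 2 + \sum_j w i j * wsum j) * D i f)
  = 2%:R * b * (\sum_i wsum i * D i (D i f))
    + b ^+ 2 * \sum_i (2%:R * wsum i ^+ 2 + 2%:R * \sum_j w i j * wsum j) * D i f.
  rewrite mulrDr; congr (_ + _).
  by rewrite !mulr_sumr; apply: eq_bigr => i _; ring.
(* [sum_w_wsum] removes the inner sum over j at the cost of a constant multiple of E. *)
rewrite [X in _ + b ^+ 2 * X](eq_bigr (fun i =>
    3%:R * ((wsum i ^+ 2 - wsqsum i) * D i f) - (#|T|.-1 * #|T|.-2)%:R * D i f)).
  by rewrite sumrB -!mulr_sumr /D_total; ring.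
by move=> i _; rewrite sum_w_wsum; ring.
Qed.

(** * Averaging over r-subsets *)

Section Reduction.
Variable r : nat.
Local Notation m k := ((supersets T r k)%:R : F).
Implicit Types (I : {set T}) (f : F).

Definition cut (g : T -> T -> F) I := \sum_(i in I) \sum_(j in ~: I) g i j.
Definition D_in I f := \sum_(i in I) D i f.
(** [scalar1], [scalar2], [scalar3] are the parts depending on I of the coefficients of h, h^2, h^3
    in the logarithm of the product of all factors with i in I and j outside I; what is left depends
    only on the cardinality of I. *)
Definition scalar1 I := b * cut w I.
Definition scalar2 I := - (b ^+ 2 * cut (fun i j => w i j ^+ 2) I) / 2%:R.
Definition scalar3 I :=
  b ^+ 3 * (cut (fun i j => w i j ^+ 3) I - cut w I) / 3%:R.

Lemma cut_sum g I : cut g I = \sum_(i in I) \sum_j g i j - \sum_(i in I) \sum_(j in I) g i j.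
Proof.
rewrite -sumrB; apply: eq_bigr => i _; rewrite [in RHS](bigID (mem I)) /= addrAC subrr add0r.
by apply: eq_bigl => j; rewrite inE.
Qed.

Lemma cut_antisym g I : (forall i j, g j i = - g i j) -> cut g I = \sum_(i in I) \sum_j g i j.
Proof. by move=> ganti; rewrite cut_sum sum_antisym ?subr0. Qed.

(** By [sum_wsum_wsqsum] this is the constant N (N - 1)(N - 2) / 3 with N = #|T|. *)
Definition wdefect := \sum_i (wsum i ^+ 2 - wsqsum i).

(** By [cut_sum] the bracket is a sum over i, j in I of W_i W_j + w_ij^2 minus a sum over i in I, so
    that [sum_subsets3] and [sum_subsets2] apply; the row sums of W vanish. It serves for a_i = D_i
    f and for a_i = W_i. *)
Lemma sum_scalar2 (a : T -> F) :
  \sum_(I : {set T} | #|I| == r)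
     ((\sum_(i in I) wsum i) ^+ 2 - cut (fun i j => w i j ^+ 2) I) * \sum_(k in I) a k
  = (m 2 - m 3) * wdefect * (\sum_i a i)
    + (m 1 - 3%:R * m 2 + 2%:R * m 3) * \sum_i (wsum i ^+ 2 - wsqsum i) * a i.
Proof.
transitivity (
  \sum_(I : {set T} | #|I| == r) \sum_(i in I) \sum_(j in I) \sum_(k in I)
     (wsum i * wsum j + w i j ^+ 2) * a k
  - \sum_(I : {set T} | #|I| == r) \sum_(i in I) \sum_(k in I) wsqsum i * a k).
  rewrite -sumrB; apply: eq_bigr => I _.
  under [X in _ = X - _]eq_bigr => i _ do under eq_bigr => j _ do rewrite -mulr_sumr.
  under [X in _ = X - _]eq_bigr => i _ do rewrite -mulr_suml big_split /= -mulr_sumr.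
  under [X in _ = _ - X]eq_bigr => i _ do rewrite -mulr_sumr.
  by rewrite -!mulr_suml big_split /= -mulr_suml cut_sum expr2 /wsqsum; ring.
rewrite sum_subsets3 sum_subsets2.
have -> : \sum_i \sum_j \sum_k (wsum i * wsum j + w i j ^+ 2) * a k =
    (\sum_i wsqsum i) * \sum_i a i.
  under eq_bigr => i _ do under eq_bigr => j _ do rewrite -mulr_sumr.
  under eq_bigr => i _ do rewrite -mulr_suml big_split /= -mulr_sumr sum_wsum mulr0 add0r.
  by rewrite -mulr_suml.
have -> : \sum_i \sum_k ((wsum i * wsum i + w i i ^+ 2) * a k + (wsum i * wsum k + w i k ^+ 2) * a i
     + (wsum k * wsum i + w k i ^+ 2) * a i)
   = (\sum_i wsum i ^+ 2) * \sum_i a i + 2%:R * \sum_i wsqsum i * a i.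
  rewrite mulr_suml mulr_sumr -big_split /=; apply: eq_bigr => i _.
  transitivity (\sum_k (wsum i ^+ 2 * a k + 2%:R * (w i k ^+ 2 * a i)
      + wsum k * (2%:R * wsum i * a i))).
    by apply: eq_bigr => k _; rewrite w_diag w_anti; ring.
  by rewrite !big_split /= -!mulr_sumr -!mulr_suml sum_wsum mul0r addr0.
have -> : \sum_i \sum_j wsqsum i * a j = (\sum_i wsqsum i) * \sum_i a i.
  by rewrite mulr_suml; apply: eq_bigr => i _; rewrite mulr_sumr.
have -> : \sum_i (wsum i * wsum i + w i i ^+ 2) * a i = \sum_i wsum i ^+ 2 * a i.
  by apply: eq_bigr => i _; rewrite w_diag; ring.
have -> : \sum_i (wsum i ^+ 2 - wsqsum i) * a i = \sum_i wsum i ^+ 2 * a i - \sum_i wsqsum i * a i.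
  by rewrite -sumrB; apply: eq_bigr => i _; rewrite mulrBl.
by rewrite /wdefect sumrB; ring.
Qed.

Lemma cut_w I : cut w I = \sum_(i in I) wsum i.
Proof. exact: cut_antisym. Qed.

Lemma D_in2 I f : D_in I (D_in I f) = \sum_(i in I) \sum_(j in I) D i (D j f).
Proof. by apply: eq_bigr => i _; rewrite raddf_sum. Qed.

Lemma D_in3 I f : D_in I (D_in I (D_in I f)) =
  \sum_(i in I) \sum_(j in I) \sum_(k in I) D i (D j (D k f)).
Proof.
apply: eq_bigr => i _; rewrite D_in2 raddf_sum; apply: eq_bigr => j _.
exact: raddf_sum.
Qed.

Lemma sum_coef1 f :
  \sum_(I : {set T} | #|I| == r) (scalar1 I * f + D_in I f) = m 1 * D_total f.
Proof.
rewrite big_split /= sum_subsets1 -mulr_suml -mulr_sumr.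
under eq_bigr => I _ do rewrite cut_w.
by rewrite sum_subsets1 sum_wsum !mulr0 mul0r add0r.
Qed.

Lemma sum_cut_D f :
  \sum_(I : {set T} | #|I| == r) cut w I * D_in I f = (m 1 - m 2) * \sum_i wsum i * D i f.
Proof.
transitivity (\sum_(I : {set T} | #|I| == r) \sum_(i in I) \sum_(j in I) wsum i * D j f).
  by apply: eq_bigr => I _; rewrite cut_w big_distrlr.
rewrite sum_subsets2 -big_distrlr /= sum_wsum mul0r mulr0 add0r; by [].
Qed.

Lemma sum_scalar2_const :
  \sum_(I : {set T} | #|I| == r)
     ((\sum_(i in I) wsum i) ^+ 2 - cut (fun i j => w i j ^+ 2) I) = (m 1 - m 2) * wdefect.
Proof.
transitivity (
  \sum_(I : {set T} | #|I| == r) \sum_(i in I) \sum_(j in I) (wsum i * wsum j + w i j ^+ 2)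
  - \sum_(I : {set T} | #|I| == r) \sum_(i in I) wsqsum i).
  rewrite -sumrB; apply: eq_bigr => I _.
  under [X in _ = X - _]eq_bigr => i _ do rewrite big_split /= -mulr_sumr.
  by rewrite big_split /= -mulr_suml cut_sum expr2 /wsqsum; ring.
rewrite sum_subsets2 sum_subsets1.
under eq_bigr => i _ do rewrite big_split /= -mulr_sumr sum_wsum mulr0 add0r.
under [X in _ + _ * X - _]eq_bigr => i _ do rewrite w_diag expr0n addr0 -expr2.
by rewrite /wdefect sumrB /wsqsum; ring.
Qed.

Lemma D_total2 f : D_total (D_total f) = \sum_i \sum_j D i (D j f).
Proof. by apply: eq_bigr => i _; rewrite /D_total raddf_sum. Qed.

Lemma sum_D_in2 f : \sum_(I : {set T} | #|I| == r) D_in I (D_in I f)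
  = m 2 * D_total (D_total f) + (m 1 - m 2) * \sum_i D i (D i f).
Proof. by under eq_bigr => I _ do rewrite D_in2; rewrite sum_subsets2 D_total2. Qed.

Lemma D_total_D i f : D_total (D i f) = D i (D_total f).
Proof. by rewrite /D_total raddf_sum; apply: eq_bigr => j _; rewrite DC. Qed.

Lemma sum_D_in3 f : \sum_(I : {set T} | #|I| == r) D_in I (D_in I (D_in I f))
  = m 3 * D_total (D_total (D_total f)) + (m 2 - m 3) * (3%:R * \sum_i D i (D i (D_total f)))
   + (m 1 - 3%:R * m 2 + 2%:R * m 3) * \sum_i D i (D i (D i f)).
Proof.
under eq_bigr => I _ do rewrite D_in3.
rewrite sum_subsets3 D_total2; congr (_ * _ + _ * _ + _).
  apply: eq_bigr => i _; apply: eq_bigr => j _.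
  by rewrite /D_total !raddf_sum.
rewrite mulr_sumr; apply: eq_bigr => i _; rewrite /D_total !raddf_sum mulr_sumr.
by apply: eq_bigr => j _; rewrite (DC j i (D i f)) (DC j i f); ring.
Qed.

Lemma sum_cut_D2 f :
  \sum_(I : {set T} | #|I| == r) cut w I * D_in I (D_in I f) =
  (m 2 - m 3) * (2%:R * \sum_i wsum i * D i (D_total f))
  + (m 1 - 3%:R * m 2 + 2%:R * m 3) * \sum_i wsum i * D i (D i f).
Proof.
transitivity (\sum_(I : {set T} | #|I| == r) \sum_(i in I) \sum_(j in I) \sum_(k in I)
    wsum i * D j (D k f)).
  apply: eq_bigr => I _; rewrite cut_w D_in2 mulr_suml; apply: eq_bigr => i _.
  by rewrite mulr_sumr; apply: eq_bigr => j _; rewrite mulr_sumr.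
rewrite sum_subsets3.
have -> : \sum_i \sum_j \sum_k wsum i * D j (D k f) = 0.
  under eq_bigr => i _ do under eq_bigr => j _ do rewrite -mulr_sumr.
  under eq_bigr => i _ do rewrite -mulr_sumr.
  by rewrite -mulr_suml sum_wsum mul0r.
rewrite mulr0 add0r; congr (_ * _ + _).
transitivity (\sum_i \sum_k 2%:R * (wsum i * D i (D k f)) + \sum_i \sum_k wsum k * D i (D i f)).
  rewrite -big_split; apply: eq_bigr => i _; rewrite -big_split; apply: eq_bigr => k _ /=.
  by rewrite (DC k i); ring.
rewrite [X in _ + X]big1 ?addr0 => [|i _]; last by rewrite -mulr_suml sum_wsum mul0r.
rewrite mulr_sumr; apply: eq_bigr => i _; rewrite /D_total raddf_sum !mulr_sumr.
by [].
Qed.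

(** Up to the factor b^3 / 6 this is the zeroth-order term of the h^3 coefficient. The antisymmetry
    of w^3 and the vanishing of the sum of the W_i leave only a multiple of [sum_wsum3]. *)
Lemma sum_cut3 :
  \sum_(I : {set T} | #|I| == r) (2%:R * (cut (fun i j => w i j ^+ 3) I - cut w I)
    - 3%:R * cut w I * cut (fun i j => w i j ^+ 2) I + cut w I ^+ 3) = 0.
Proof.
have antisym3 i j : w j i ^+ 3 = - w i j ^+ 3 by rewrite w_anti exprNn; ring.
transitivity (2%:R * \sum_(I : {set T} | #|I| == r) (\sum_(i in I) \sum_j w i j ^+ 3)
  - 2%:R * (\sum_(I : {set T} | #|I| == r) \sum_(i in I) wsum i)
  + 3%:R * (\sum_(I : {set T} | #|I| == r)
     ((\sum_(i in I) wsum i) ^+ 2 - cut (fun i j => w i j ^+ 2) I) * \sum_(k in I) wsum k)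
  - 2%:R * (\sum_(I : {set T} | #|I| == r) \sum_(i in I) \sum_(j in I) \sum_(k in I)
      wsum i * wsum j * wsum k)).
  rewrite !mulr_sumr -sumrB -big_split -sumrB /=; apply: eq_bigr => I _.
  have -> : \sum_(i in I) \sum_(j in I) \sum_(k in I) wsum i * wsum j * wsum k = cut w I ^+ 3.
    under eq_bigr => i _ do under eq_bigr => j _ do rewrite -mulr_sumr -cut_w.
    under eq_bigr => i _ do rewrite -mulr_suml -mulr_sumr -cut_w.
    by rewrite -!mulr_suml -cut_w; ring.
  by rewrite (cut_antisym _ antisym3) -!cut_w; ring.
rewrite sum_scalar2 !sum_subsets1 sum_subsets3 (sum_antisym xpredT antisym3) sum_wsum.
have -> : \sum_i \sum_j \sum_k wsum i * wsum j * wsum k = 0.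
  under eq_bigr => i _ do under eq_bigr => j _ do rewrite -mulr_sumr sum_wsum mulr0.
  by rewrite big1 // => i _; rewrite big1.
have -> : \sum_i \sum_k (wsum i * wsum i * wsum k + wsum i * wsum k * wsum i
    + wsum k * wsum i * wsum i) = 0.
  rewrite big1 // => i _; transitivity (\sum_k 3%:R * wsum i ^+ 2 * wsum k).
    by apply: eq_bigr => k _; ring.
  by rewrite -mulr_sumr sum_wsum mulr0.
rewrite !mulr0 subr0 !add0r mulrCA [X in _ - X]mulrCA -mulrBr !mulr_sumr -sumrB.
rewrite [X in _ * X](_ : _ = 0) ?mulr0 // -[RHS]sum_wsum3.
by apply: eq_bigr => i _; ring.
Qed.

Lemma sum_coef2 f :
  2%:R * \sum_(I : {set T} | #|I| == r)
    ((scalar2 I + scalar1 I ^+ 2 / 2%:R) * f + scalar1 I * D_in I f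
      + D_in I (D_in I f) / 2%:R)
  = b ^+ 2 * (m 1 - m 2) * wdefect * f + (m 1 - m 2) * laplace f + m 2 * D_total (D_total f).
Proof.
transitivity (\sum_(I : {set T} | #|I| == r)
    (b ^+ 2 * ((\sum_(i in I) wsum i) ^+ 2 - cut (fun i j => w i j ^+ 2) I) * f
     + 2%:R * b * (cut w I * D_in I f) + D_in I (D_in I f))).
  rewrite mulr_sumr; apply: eq_bigr => I _; rewrite /scalar1 /scalar2 -cut_w.
  by field.
rewrite !big_split /= -mulr_suml -!mulr_sumr.
rewrite sum_scalar2_const sum_cut_D sum_D_in2 /laplace.
by ring.
Qed.

(** The sums of degree 3 in the indicator of I assemble into H_3; the last multiple of E undoes the
    one contained in [lax_trace3]. *)
Lemma sum_coef3 f :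
  6%:R * \sum_(I : {set T} | #|I| == r)
    ((scalar3 I + scalar1 I * scalar2 I + scalar1 I ^+ 3 / 6%:R) * f
      + (scalar2 I + scalar1 I ^+ 2 / 2%:R) * D_in I f
      + scalar1 I * (D_in I (D_in I f) / 2%:R)
      + D_in I (D_in I (D_in I f)) / 6%:R)
  = m 3 * D_total (D_total (D_total f))
    + 3%:R * (m 2 - m 3) * (b ^+ 2 * wdefect * D_total f + laplace (D_total f))
    + (m 1 - 3%:R * m 2 + 2%:R * m 3)
      * (lax_trace 3 f + b ^+ 2 * (#|T|.-1 * #|T|.-2)%:R * D_total f).
Proof.
transitivity (\sum_(I : {set T} | #|I| == r)
    ((2%:R * (cut (fun i j => w i j ^+ 3) I - cut w I)
    - 3%:R * cut w I * cut (fun i j => w i j ^+ 2) I + cut w I ^+ 3) * (b ^+ 3 * f)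
    + 3%:R * b ^+ 2 * (((\sum_(i in I) wsum i) ^+ 2 - cut (fun i j => w i j ^+ 2) I) * D_in I f)
     + 3%:R * b * (cut w I * D_in I (D_in I f)) + D_in I (D_in I (D_in I f)))).
  rewrite mulr_sumr; apply: eq_bigr => I _; rewrite /scalar1 /scalar2 /scalar3 -cut_w.
  have six_neq0 : 6%:R != 0 :> F by rewrite (natrM F 2 3) mulf_neq0.
  by field; rewrite six_neq0 two_neq0 three_neq0.
rewrite !big_split /= -mulr_suml -!mulr_sumr sum_cut3 mul0r add0r.
rewrite sum_scalar2 sum_cut_D2 sum_D_in3 lax_trace3 /laplace -/(D_total f).
by ring.
Qed.

End Reduction.

(** * The commuting operators E, H and H_3 *)

Definition dconst c := forall i, D i c = 0.

Lemma laxD phi psi i : lax (fun j => phi j + psi j) i = lax phi i + lax psi i.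
Proof.
rewrite /lax raddfD /= addrACA -mulrDr -big_split /=; congr (_ + _ * _).
by apply: eq_bigr => j _; ring.
Qed.

Lemma lax_scale c phi i : dconst c -> lax (fun j => c * phi j) i = c * lax phi i.
Proof.
move=> Dc; rewrite /lax D_const_scale // mulrDr mulrCA [c * \sum__ _]mulr_sumr; congr (_ + _ * _).
by apply: eq_bigr => j _; ring.
Qed.

Lemma D_totalD x y : D_total (x + y) = D_total x + D_total y.
Proof. by rewrite -big_split; apply: eq_bigr => i _; rewrite raddfD. Qed.

Lemma D_total_scale c x : dconst c -> D_total (c * x) = c * D_total x.
Proof. by move=> Dc; rewrite mulr_sumr; apply: eq_bigr => i _; rewrite D_const_scale. Qed.

(** w_ij has degree 0, so E annihilates it; therefore E commutes with the Lax matrix. *)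
Lemma D_total_w i j x : D_total (w i j * x) = w i j * D_total x.
Proof.
rewrite /D_total; under eq_bigr => k _ do rewrite DM.
rewrite big_split /= -mulr_sumr -mulr_suml.
have -> : \sum_k D k (w i j) = \sum_k 1 * D k (w i j) by apply: eq_bigr => k _; rewrite mul1r.
by rewrite sum_wdelta subrr mulr0 mul0r add0r.
Qed.

Lemma D_total_sum (g : T -> F) : D_total (\sum_i g i) = \sum_i D_total (g i).
Proof. by rewrite [RHS]exchange_big; apply: eq_bigr => i _; rewrite raddf_sum. Qed.

Lemma D_totalB x y : D_total (x - y) = D_total x - D_total y.
Proof. by rewrite -sumrB; apply: eq_bigr => i _; rewrite raddfB. Qed.

Lemma D_total_lax phi i : D_total (lax phi i) = lax (fun j => D_total (phi j)) i.
Proof.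
rewrite D_totalD D_total_D (D_total_scale _ Db) D_total_sum; congr (_ + _ * _).
by apply: eq_bigr => j _; rewrite D_total_w D_totalB.
Qed.

Lemma D_total_lax_trace k f : D_total (lax_trace k f) = lax_trace k (D_total f).
Proof.
rewrite /lax_trace D_total_sum; apply: eq_bigr => i _.
elim: k i => [|k IHk] i //=.
by rewrite D_total_lax; apply: eq_lax.
Qed.

Lemma lax_traceD k x y : lax_trace k (x + y) = lax_trace k x + lax_trace k y.
Proof.
rewrite /lax_trace -big_split; apply: eq_bigr => i _ /=.
elim: k i => [|k IHk] i //=.
by rewrite -laxD; apply: eq_lax.
Qed.

Lemma lax_trace_scale k c x : dconst c -> lax_trace k (c * x) = c * lax_trace k x.
Proof.
move=> Dc; rewrite /lax_trace mulr_sumr; apply: eq_bigr => i _ /=.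
elim: k i => [|k IHk] i //=.
by rewrite -lax_scale //; apply: eq_lax.
Qed.

Lemma D_total_laplace f : D_total (laplace f) = laplace (D_total f).
Proof. by rewrite -!lax_trace2 D_total_lax_trace. Qed.

(** The monomials of order at most 3 in E, H and H_3, which have orders 1, 2 and 3. *)
Definition jack_comb (c : nat -> F) f := c 0%N * f + c 1%N * D_total f
  + c 2%N * D_total (D_total f) + c 3%N * D_total (D_total (D_total f)) + c 4%N * laplace f
  + c 5%N * D_total (laplace f) + c 6%N * lax_trace 3 f.

Definition jack_op (X : F -> F) :=
  exists2 c : nat -> F, (forall k, dconst (c k)) & forall f, X f = jack_comb c f.

(** H is treated as [lax_trace 2], so that the rules for E and for constants cover H and H_3 alike;
    the only other commutation required is that of H with H_3. *)
Lemma jack_op_comm X Y f : jack_op X -> jack_op Y -> X (Y f) = Y (X f).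
Proof.
move=> [c Dc eX] [d Dd eY]; rewrite !eX !eY /jack_comb -!lax_trace2.
have comm23 x : lax_trace 2 (lax_trace 3 x) = lax_trace 3 (lax_trace 2 x).
  by rewrite !lax_trace2 laplace_lax_trace.
rewrite !(D_totalD, lax_traceD).
rewrite !(D_total_scale _ (Dc _), D_total_scale _ (Dd _),
  lax_trace_scale _ _ (Dc _), lax_trace_scale _ _ (Dd _)).
by rewrite !(D_total_lax_trace, comm23); ring.
Qed.

Lemma eq_jack_op X Y : X =1 Y -> jack_op X -> jack_op Y.
Proof. by move=> e [c Dc eX]; exists c => // f; rewrite -e. Qed.

Lemma jack_op_add X Y : jack_op X -> jack_op Y -> jack_op (fun f => X f + Y f).
Proof.
move=> [c Dc eX] [d Dd eY]; exists (fun k => c k + d k).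
  by move=> k i; rewrite raddfD /= Dc Dd addr0.
by move=> f; rewrite eX eY /jack_comb; ring.
Qed.

Lemma dconstM c d : dconst c -> dconst d -> dconst (c * d).
Proof. by move=> Dc Dd i; rewrite DM Dc Dd mul0r mulr0 addr0. Qed.

Lemma dconstD c d : dconst c -> dconst d -> dconst (c + d).
Proof. by move=> Dc Dd i; rewrite raddfD /= Dc Dd addr0. Qed.

Lemma dconst_natr k : dconst k%:R.
Proof. by move=> i; apply: D_natr. Qed.

Lemma dconst_div k c : k%:R != 0 :> F -> dconst (k%:R * c) -> dconst c.
Proof.
move=> k0 Dc i; apply: (mulfI k0).
by rewrite -(D_const_scale _ (D_natr i k)) Dc mulr0.
Qed.

Lemma dconst_natV k : k%:R != 0 :> F -> dconst k%:R^-1.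
Proof.
by move=> k0; apply: (dconst_div k0); rewrite divff //; apply: (dconst_natr 1).
Qed.

Lemma jack_op_scale c X : dconst c -> jack_op X -> jack_op (fun f => c * X f).
Proof.
move=> Dc [d Dd eX]; exists (fun k => c * d k) => [k|f]; first exact: dconstM.
by rewrite eX /jack_comb; ring.
Qed.

Lemma jack_op_div k X : k%:R != 0 :> F -> jack_op (fun f => k%:R * X f) -> jack_op X.
Proof.
move=> k0 kX; apply: eq_jack_op (jack_op_scale (dconst_natV k0) kX) => f.
exact: mulKf.
Qed.

Let unit_comb j : nat -> F := fun k => (k == j)%:R.
Let dconst_unit_comb j k : dconst (unit_comb j k). Proof. exact: dconst_natr. Qed.

Lemma jack_op_id : jack_op id.
Proof. by exists (unit_comb 0) => // f; rewrite /jack_comb /unit_comb /=; ring. Qed.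

Lemma jack_op_total : jack_op D_total.
Proof. by exists (unit_comb 1) => // f; rewrite /jack_comb /unit_comb /=; ring. Qed.

Lemma jack_op_total2 : jack_op (fun f => D_total (D_total f)).
Proof. by exists (unit_comb 2) => // f; rewrite /jack_comb /unit_comb /=; ring. Qed.

Lemma jack_op_total3 : jack_op (fun f => D_total (D_total (D_total f))).
Proof. by exists (unit_comb 3) => // f; rewrite /jack_comb /unit_comb /=; ring. Qed.

Lemma jack_op_laplace : jack_op laplace.
Proof. by exists (unit_comb 4) => // f; rewrite /jack_comb /unit_comb /=; ring. Qed.

Lemma jack_op_laplace_total : jack_op (fun f => laplace (D_total f)).
Proof.
by exists (unit_comb 5) => // f; rewrite /jack_comb /unit_comb /= D_total_laplace; ring.
Qed.

Lemma jack_op_lax_trace3 : jack_op (lax_trace 3).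
Proof. by exists (unit_comb 6) => // f; rewrite /jack_comb /unit_comb /=; ring. Qed.

Lemma dconst_wdefect : dconst wdefect.
Proof. by apply: (dconst_div three_neq0); rewrite sum_wsum_wsqsum; apply: dconst_natr. Qed.

Lemma dconstB c d : dconst c -> dconst d -> dconst (c - d).
Proof. by move=> Dc Dd i; rewrite raddfB /= Dc Dd subr0. Qed.

(** * The averaged coefficients as combinations of E, H and H_3 *)

Section Coefficients.
Variable r : nat.
Local Notation m k := ((supersets T r k)%:R : F).

(* The coefficients of h^0, ..., h^3 in D_n^r, up to a scalar power series. *)
Definition coef0 (f : F) := \sum_(I : {set T} | #|I| == r) f.
Definition coef1 (f : F) := \sum_(I : {set T} | #|I| == r) (scalar1 I * f + D_in I f).
Definition coef2 (f : F) := \sum_(I : {set T} | #|I| == r)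
  ((scalar2 I + scalar1 I ^+ 2 / 2%:R) * f + scalar1 I * D_in I f
    + D_in I (D_in I f) / 2%:R).
Definition coef3 (f : F) := \sum_(I : {set T} | #|I| == r)
  ((scalar3 I + scalar1 I * scalar2 I + scalar1 I ^+ 3 / 6%:R) * f
    + (scalar2 I + scalar1 I ^+ 2 / 2%:R) * D_in I f
    + scalar1 I * (D_in I (D_in I f) / 2%:R)
    + D_in I (D_in I (D_in I f)) / 6%:R).

Lemma jack_op_coef0 : jack_op coef0.
Proof.
apply: eq_jack_op (jack_op_scale (dconst_natr #|[pred I : {set T} | #|I| == r]|) jack_op_id) => f.
by rewrite /coef0 sumr_const mulr_natl.
Qed.

Lemma jack_op_coef1 : jack_op coef1.
Proof.
by apply: eq_jack_op (jack_op_scale (dconst_natr _) jack_op_total) => f; rewrite /coef1 sum_coef1.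
Qed.

Let dconst_b2 : dconst (b ^+ 2). Proof. exact: dconstM. Qed.
Let dconst_m12 : dconst (m 1 - m 2). Proof. by apply: dconstB; apply: dconst_natr. Qed.

Lemma jack_op_coef2 : jack_op coef2.
Proof.
apply: (jack_op_div two_neq0).
apply: (@eq_jack_op (fun f => b ^+ 2 * (m 1 - m 2) * wdefect * f
  + (m 1 - m 2) * laplace f + m 2 * D_total (D_total f))) => [f|].
  by rewrite sum_coef2.
apply: jack_op_add (jack_op_scale (dconst_natr _) jack_op_total2).
apply: jack_op_add (jack_op_scale _ jack_op_laplace) => //.
by apply: jack_op_scale jack_op_id; do !apply: dconstM => //; apply: dconst_wdefect.
Qed.

Lemma jack_op_coef3 : jack_op coef3.
Proof.
have six : 6%:R != 0 :> F by rewrite (natrM F 2 3) mulf_neq0.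
apply: (jack_op_div six).
apply: (@eq_jack_op (fun f => m 3 * D_total (D_total (D_total f))
    + 3%:R * (m 2 - m 3) * (b ^+ 2 * wdefect * D_total f + laplace (D_total f))
    + (m 1 - 3%:R * m 2 + 2%:R * m 3)
      * (lax_trace 3 f + b ^+ 2 * (#|T|.-1 * #|T|.-2)%:R * D_total f))) => [f|].
  by rewrite sum_coef3.
apply: jack_op_add; last apply: jack_op_scale.
- apply: jack_op_add (jack_op_scale (dconst_natr _) jack_op_total3) _.
  apply: jack_op_scale.
    by apply: dconstM; [|apply: dconstB]; apply: dconst_natr.
  apply: jack_op_add jack_op_laplace_total.
  by apply: jack_op_scale jack_op_total; apply: dconstM => //; apply: dconst_wdefect.
- by apply: dconstD; [apply: dconstB; [|apply: dconstM]|apply: dconstM]; apply: dconst_natr.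
apply: jack_op_add jack_op_lax_trace3 _.
by apply: jack_op_scale jack_op_total; apply: dconstM => //; apply: dconst_natr.
Qed.

End Coefficients.
End Lax.

(** * Euler operators on rational functions *)

Section EulerOperators.
Variables (K : fieldType) (n : nat).
Local Notation F := (ratfun K n).
Local Notation "p %:Fr" := (FracField.tofrac (p : {mpoly K[n]}) : F) (at level 2, format "p %:Fr").
Implicit Types (u v : F) (p q : {mpoly K[n]}) (i j : 'I_n).

Lemma ratfunP u : exists p q, q != 0 /\ u = p%:Fr / q%:Fr.
Proof.
exists \n_(repr u), \d_(repr u); split; first exact: denom_ratioP.
exact: reprE.
Qed.

Lemma rderivD i u v : rderiv i (u + v) = rderiv i u + rderiv i v.
Proof.
have [a [c [c0 ->]]] := ratfunP u; have [p [q [q0 ->]]] := ratfunP v.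
have cF : c%:Fr != 0 by rewrite tofrac_eq0.
have qF : q%:Fr != 0 by rewrite tofrac_eq0.
have -> : a%:Fr / c%:Fr + p%:Fr / q%:Fr = (a * q + p * c)%:Fr / (c * q)%:Fr.
  by rewrite (addf_div _ _ cF qF) (tofracD (a * q)) (tofracM a q) (tofracM p c) (tofracM c q).
rewrite (rderiv_frac i a c0) (rderiv_frac i p q0) (rderiv_frac i _ (mulf_neq0 c0 q0)).
set A := mderiv i a * c - _; set P := mderiv i p * q - _.
have -> : mderiv i (a * q + p * c) * (c * q) - (a * q + p * c) * mderiv i (c * q)
    = A * q ^+ 2 + P * c ^+ 2.
  by rewrite mderivD !mderivM /A /P; ring.
rewrite (tofracD (A * _)) (tofracM A) (tofracM P) (tofracXn 2 c) (tofracXn 2 q).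
rewrite (tofracXn 2 (c * q)) (tofracM c q).
(* The identity is checked for arbitrary elements of a field and then specialized to numerators and
   denominators. *)
have key (L : fieldType) (x y z t : L) : z != 0 -> t != 0 ->
  (x * t ^+ 2 + y * z ^+ 2) / (z * t) ^+ 2 = x / z ^+ 2 + y / t ^+ 2.
  by move=> z0 t0; field; rewrite z0 t0.
exact: (key F A%:Fr P%:Fr _ _ cF qF).
Qed.

Lemma rderivM i u v : rderiv i (u * v) = rderiv i u * v + u * rderiv i v.
Proof.
have [a [c [c0 ->]]] := ratfunP u; have [p [q [q0 ->]]] := ratfunP v.
have cF : c%:Fr != 0 by rewrite tofrac_eq0.
have qF : q%:Fr != 0 by rewrite tofrac_eq0.
have -> : a%:Fr / c%:Fr * (p%:Fr / q%:Fr) = (a * p)%:Fr / (c * q)%:Fr.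
  by rewrite mulf_div (tofracM a p) (tofracM c q).
rewrite (rderiv_frac i a c0) (rderiv_frac i p q0) (rderiv_frac i _ (mulf_neq0 c0 q0)).
set A := mderiv i a * c - _; set P := mderiv i p * q - _.
have -> : mderiv i (a * p) * (c * q) - (a * p) * mderiv i (c * q)
    = A * (p * q) + (a * c) * P.
  by rewrite !mderivM /A /P; ring.
rewrite (tofracD (A * _)) (tofracM A) (tofracM p q) (tofracM (a * c)) (tofracM a c).
rewrite (tofracXn 2 c) (tofracXn 2 q) (tofracXn 2 (c * q)) (tofracM c q).
have key (L : fieldType) (x y z t k l : L) : z != 0 -> t != 0 ->
  (x * (k * t) + (l * z) * y) / (z * t) ^+ 2 = x / z ^+ 2 * (k / t) + l / z * (y / t ^+ 2).
  by move=> z0 t0; field; rewrite z0 t0.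
exact: (key F A%:Fr P%:Fr _ _ p%:Fr a%:Fr cF qF).
Qed.

(** For v = p / q, the equation v q = p is differentiated in both orders. The mixed terms agree, as
    do the second derivatives of p and q, so q times the two iterated derivatives of v coincide. *)
Lemma rderiv_comm i j u : rderiv i (rderiv j u) = rderiv j (rderiv i u).
Proof.
have [p [q [q0 ->]]] := ratfunP u; set v := _ / _.
have qF : q%:Fr != 0 by rewrite tofrac_eq0.
have vq : v * q%:Fr = p%:Fr by exact: divfK.
clearbody v.
have d k l : (mderiv k (mderiv l p))%:Fr = (rderiv k (rderiv l v) * q%:Fr
    + rderiv l v * (mderiv k q)%:Fr) + (rderiv k v * (mderiv l q)%:Fr
    + v * (mderiv k (mderiv l q))%:Fr).
  by rewrite -!rderiv_tofrac -vq (rderivM l v) rderivD (rderivM k v) (rderivM k (rderiv l v)).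
have key (L : fieldType) (x y z s t : L) : (x + s) + (t + z) = (y + t) + (s + z) -> x = y.
  move=> e; apply: (addIr (s + t + z)).
  by rewrite (_ : x + _ = (x + s) + (t + z)); [rewrite e|]; ring.
apply: (mulIf qF); have := d i j; rewrite (mderiv_comm j i p) (d j i) (mderiv_comm j i q) => e.
exact/esym/(key _ _ _ _ _ _ e).
Qed.

Lemma eulerD i u v : euler i (u + v) = euler i u + euler i v.
Proof. by rewrite /euler rderivD mulrDr. Qed.

Lemma eulerM i u v : euler i (u * v) = euler i u * v + u * euler i v.
Proof. by rewrite /euler rderivM mulrDr mulrA [X in _ + X]mulrCA. Qed.

Lemma rderiv_var i j : rderiv i (ratvar K j) = (i == j)%:R.
Proof.
rewrite /ratvar rderiv_tofrac mderivX mnmE eq_sym.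
have [->|ij] := eqVneq i j; last by rewrite scale0r tofrac0.
rewrite scale1r (_ : (_ - _)%MM = 0%MM) ?mpolyX0 ?tofrac1 //.
by apply/mnmP => k; rewrite mnmBE mnm0E subnn.
Qed.

Lemma euler_comm i j u : euler i (euler j u) = euler j (euler i u).
Proof.
have [->//|ij] := eqVneq i j.
rewrite /euler (rderivM i (ratvar K j)) (rderivM j (ratvar K i)) !rderiv_var.
rewrite (negPf ij) eq_sym (negPf ij) !mul0r !add0r rderiv_comm.
exact: mulrCA.
Qed.

Lemma euler_var i j : euler i (ratvar K j) = ratvar K j * (i == j)%:R.
Proof.
rewrite /euler rderiv_var; have [->//|_] := eqVneq i j.
by rewrite (mulr0 (ratvar K i)) (mulr0 (ratvar K j)).
Qed.

Lemma euler_const i (c : K) : euler i (ratconst n c) = 0.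
Proof. by rewrite /euler /ratconst rderiv_tofrac mderivC tofrac0 mulr0. Qed.

Lemma euler0 i : euler i (0 : F) = 0.
Proof. by have /esym/eqP := eulerD i 0 0; rewrite addr0 -subr_eq0 addrK => /eqP. Qed.

HB.instance Definition _ i := GRing.isNmodMorphism.Build F F (@euler K n i)
  (conj (euler0 i) (eulerD i)).

Lemma ratvar_neq i j : i != j -> ratvar K i - ratvar K j != 0.
Proof.
move=> ij; rewrite /ratvar -tofracB tofrac_eq0 subr_eq0; apply/eqP => /(congr1 (mcoeff U_(i))).
by rewrite !mcoeffXU eqxx eq_sym (negPf ij) => /eqP; rewrite oner_eq0.
Qed.

(** On the diagonal the division by zero gives 0, in accordance with antisymmetry. *)
Definition wratio i j : F := (ratvar K i + ratvar K j) / (ratvar K i - ratvar K j).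

Lemma wratio_anti i j : wratio j i = - wratio i j.
Proof. by rewrite /wratio -opprB invrN mulrN addrC. Qed.

(** The addition theorem of coth: w_ij = coth((u_i - u_j) / 2) for x_i = exp(u_i), and the three
    arguments sum to zero. *)
Lemma wratio_triple i j k : i != j -> j != k -> i != k ->
  wratio i j * wratio j k + wratio j k * wratio k i + wratio k i * wratio i j = -1.
Proof.
move=> /ratvar_neq ij /ratvar_neq jk ik; have ki : k != i by rewrite eq_sym.
have key (L : fieldType) (x y z : L) : x - y != 0 -> y - z != 0 -> z - x != 0 ->
  (x + y) / (x - y) * ((y + z) / (y - z)) + (y + z) / (y - z) * ((z + x) / (z - x))
  + (z + x) / (z - x) * ((x + y) / (x - y)) = -1.
  by move=> xy yz zx; field; rewrite xy yz zx.
exact: (key F (ratvar K i) (ratvar K j) (ratvar K k) ij jk (ratvar_neq ki)).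
Qed.

Hypothesis two_neq0 : 2%:R != 0 :> F.

(** For i != j, apply D_k to w_ij (x_i - x_j) = x_i + x_j and solve for D_k w_ij. *)
Lemma euler_wratio k i j : euler k (wratio i j) =
  (if i == j then 0 else (1 - wratio i j ^+ 2) / 2%:R) * ((k == i)%:R - (k == j)%:R).
Proof.
case: eqVneq => [->|ij]; first by rewrite /wratio subrr invr0 mulr0 euler0 mul0r.
have key (L : fieldType) (x y a c z : L) : x - y != 0 -> 2%:R != 0 :> L ->
    z * (x - y) + (x + y) / (x - y) * (x * a - y * c) = x * a + y * c ->
    z = (1 - ((x + y) / (x - y)) ^+ 2) / 2%:R * (a - c).
  move=> xy nz2 e; apply: (mulIf xy); apply: (addIr ((x + y) / (x - y) * (x * a - y * c))).
  by rewrite e; field; rewrite nz2 xy.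
apply: (key F (ratvar K i) (ratvar K j) _ _ _ (ratvar_neq ij) two_neq0).
rewrite -(euler_var k i) -(euler_var k j) -(raddfB (euler k)) -(raddfD (euler k)).
rewrite -(eulerM k (wratio i j)); congr (euler k _).
exact: divfK (ratvar_neq ij) _.
Qed.

End EulerOperators.

(** * Expansion of the Macdonald operators *)

Section Expansion.
Variables (K : fieldType) (n : nat) (beta : K).
Hypothesis char0 : [pchar K] =i pred0.
Local Notation F := (ratfun K n).
Implicit Types (i j : 'I_n) (I : {set 'I_n}) (f : F).

Lemma ratfun_natr_neq0 k : k.+1%:R != 0 :> F.
Proof.
rewrite -(rmorph_nat (@FracField.tofrac {mpoly K[n]})) tofrac_eq0.
rewrite -mpolyC_nat mpolyC_eq0.
by have /pcharf0P-> := char0.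
Qed.

Local Notation b := (ratconst n (beta / 2%:R)).
Local Notation D := (fun i : 'I_n => (@euler K n i : {additive F -> F})).
Local Notation w := (@wratio K n).
Let two := ratfun_natr_neq0 1.
Let three := ratfun_natr_neq0 2.

Lemma exp3_tseries : exp3 (tseries n beta) (2%:R * b) 0 0.
Proof.
have two0 : 2%:R != 0 :> K by have /pcharf0P-> := char0.
have double (c : K) : 2%:R * ratconst n c = ratconst n (c * 2%:R).
  by rewrite mulrC /ratconst mpolyCM mpolyC_nat tofracM
    (rmorph_nat (@FracField.tofrac {mpoly K[n]})).
rewrite double divfK //.
exact: exp3_sexp.
Qed.

Lemma exp3_macdonald_factor i j : i != j ->
  exp3 (factor beta i j) (b * (1 + w i j)) (b ^+ 2 * (1 - w i j ^+ 2) / 2%:R)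
    (b ^+ 3 * (w i j ^+ 3 - w i j) / 3%:R).
Proof. move=> /(ratvar_neq K) ij; exact: (exp3_factor two three ij exp3_tseries). Qed.

(** The Euler operators commute, so the exponents of the shifts add; the induction runs over the
    enumeration of the indices. *)
Lemma opexp3_qshift I : opexp3 (\big[@opcomp F/@opone F]_(i in I) qshift i) (D_in D I).
Proof.
have D_in_comm s (f : F) j : euler j (\sum_(i <- s | i \in I) euler i f) =
    \sum_(i <- s | i \in I) euler i (euler j f).
  rewrite (raddf_sum (euler j)) /=; apply: eq_bigr => i _; exact: euler_comm.
rewrite /D_in; elim: (index_enum _) => [|i s IHs].
  by move=> f; rewrite !big_nil; exact: opexp3_one.
have [iI|iI] := boolP (i \in I); last first.
  move=> f; rewrite !big_cons (negPf iI); exact: IHs.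
rewrite big_cons iI.
apply: (@eq_opexp3 F _ (fun f => euler i f + \sum_(j <- s | j \in I) euler j f)) => [f|].
  by rewrite big_cons iI.
apply: (@opexp3_comp F two three _ _ (@euler K n i : {additive F -> F})) IHs => [f|x y|].
- exact: D_in_comm.
- by rewrite -big_split; apply: eq_bigr => j _; exact: eulerD.
- exact: opexp3_exp.
Qed.

Definition cut_size I : F := \sum_(i in I) \sum_(j in ~: I) 1.

Lemma cut_sizeE I r : #|I| = r -> cut_size I = (r * (n - r))%:R.
Proof.
move=> Ir; rewrite /cut_size; under eq_bigr => i _ do rewrite sumr_const cardsCs setCK Ir card_ord.
by rewrite sumr_const Ir -mulrnA mulnC.
Qed.

(** The logarithms of the factors are summed. The 1 in 1 + w_ij and in 1 - w_ij^2 gives the r (n -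
    r) terms; the cubic coefficient has no such constant. *)
Lemma exp3_macdonald_product I r : #|I| = r ->
  exp3 (\big[@smul F/sconst 1]_(i in I) \big[@smul F/sconst 1]_(j in ~: I) factor beta i j)
    ((r * (n - r))%:R * b + scalar1 w b I)
    ((r * (n - r))%:R * b ^+ 2 / 2%:R + scalar2 w b I) (scalar3 w b I).
Proof.
move=> Ir.
pose a1 i j := b * (1 + w i j); pose a2 i j := b ^+ 2 * (1 - w i j ^+ 2) / 2%:R.
pose a3 i j := b ^+ 3 * (w i j ^+ 3 - w i j) / 3%:R.
have row i : i \in I -> exp3 (\big[@smul F/sconst 1]_(j in ~: I) factor beta i j)
    (\sum_(j in ~: I) a1 i j) (\sum_(j in ~: I) a2 i j) (\sum_(j in ~: I) a3 i j).
  move=> iI; apply: (exp3_prod two three) => j; rewrite inE => jI.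
  by apply: exp3_macdonald_factor; apply: contraNneq jI => <-.
have -> : (r * (n - r))%:R * b + scalar1 w b I = \sum_(i in I) \sum_(j in ~: I) a1 i j.
  rewrite -(cut_sizeE Ir) /scalar1 mulr_suml mulr_sumr -big_split /=.
  apply: eq_bigr => i _; rewrite mulr_suml mulr_sumr -big_split /=.
  by apply: eq_bigr => j _; rewrite /a1 mulrDr mulr1 mul1r.
have -> : (r * (n - r))%:R * b ^+ 2 / 2%:R + scalar2 w b I = \sum_(i in I) \sum_(j in ~: I) a2 i j.
  rewrite -(cut_sizeE Ir) /scalar2 -mulrDl /cut_size mulr_suml mulr_sumr -sumrB mulr_suml.
  apply: eq_bigr => i _; rewrite mulr_suml mulr_sumr -sumrB mulr_suml.
  by apply: eq_bigr => j _; rewrite /a2 mul1r mulrBr mulr1.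
have -> : scalar3 w b I = \sum_(i in I) \sum_(j in ~: I) a3 i j.
  rewrite /scalar3 -sumrB mulr_sumr mulr_suml.
  apply: eq_bigr => i _; rewrite -sumrB mulr_sumr mulr_suml.
  by apply: eq_bigr => j _.
exact: (exp3_prod two three _ row).
Qed.

Local Notation jack_op := (jack_op D w b).

(** The coefficient of h^k is [coef] k plus c1 times [coef] k - 1, c2 times [coef] k - 2 and so on,
    with constants c1, c2, c3. *)
Lemma macdonald_jack_op r k : (k <= 3)%N -> jack_op (macdonald beta r k).
Proof.
pose p := spow (tseries n beta) (r * r.-1)./2.
have ep : exp3 p ((r * r.-1)./2%:R * (2%:R * b)) 0 0.
  by have := exp3_pow two three (r * r.-1)./2 exp3_tseries; rewrite mulr0.
have expand I f (Ir : #|I| == r) :=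
  opscale_exp3 two three f ep (exp3_macdonald_product (eqP Ir)) (opexp3_qshift I).
have sumE l f : macdonald beta r l f =
    \sum_(I : {set 'I_n} | #|I| == r) opscale p (macdonald_term beta I) l f.
  exact: opscale_sum.
(* The scalar series common to all r-subsets is exp(c1 h + e2 h^2); it combines the power of t in
   front with the r (n - r) pairs across the cut. *)
pose c1 : F := (r * r.-1)./2%:R * (2%:R * b) + (r * (n - r))%:R * b.
pose e2 : F := (r * (n - r))%:R * b ^+ 2 / 2%:R.
pose c2 : F := e2 + c1 ^+ 2 / 2%:R.
pose c3 : F := c1 * e2 + c1 ^+ 3 / 6%:R.
pose DM : forall i x y, D i (x * y) = D i x * y + x * D i y := @eulerM K n.
have cM x y : dconst D x -> dconst D y -> dconst D (x * y).
  exact: (dconstM DM).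
have cnat := dconst_natr DM.
(* The index is shifted by one: [cinv 1] concerns 1/2 and [cinv 5] concerns 1/6. *)
have cinv l : dconst D l.+1%:R^-1 := dconst_natV DM (ratfun_natr_neq0 l).
have cb : dconst D b by move=> i; exact: euler_const.
have cX x l : dconst D x -> dconst D (x ^+ l).
  by move=> cx; elim: l => [|l IHl]; [exact: (cnat 1) | rewrite exprS; exact: (cM)].
have cc1 : dconst D c1 := dconstD (cM _ _ (cnat _) (cM _ _ (cnat 2) cb)) (cM _ _ (cnat _) cb).
have ce2 : dconst D e2 := cM _ _ (cM _ _ (cnat _) (cX b 2 cb)) (cinv 1).
have cc2 : dconst D c2 := dconstD ce2 (cM _ _ (cX c1 2 cc1) (cinv 1)).
have cc3 : dconst D c3 := dconstD (cM _ _ cc1 ce2) (cM _ _ (cX c1 3 cc1) (cinv 5)).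
have j0 := jack_op_coef0 w b DM r.
have j1 := jack_op_coef1 b two DM (@wratio_anti K n) r.
have j2 := jack_op_coef2 two three DM cb
  (@wratio_anti K n) (@wratio_triple K n) r.
have j3 := jack_op_coef3 two three DM
  (@euler_comm K n) cb (@wratio_anti K n) (@wratio_triple K n) (@euler_wratio K n two) r.
have jZ c X : dconst D c -> jack_op X -> jack_op (fun f => c * X f).
  exact: (jack_op_scale DM).
case: k => [|[|[|[|//]]]] _.
- apply: eq_jack_op j0 => f; rewrite sumE; apply: eq_bigr => I Ir.
  by have [] := expand I f Ir.
- apply: eq_jack_op (jack_op_add j1 (jZ _ _ cc1 j0)) => f; rewrite sumE.
  rewrite /coef0 mulr_sumr -big_split; apply: eq_bigr => I Ir /=.
  by have [] := expand I f Ir.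
- apply: eq_jack_op (jack_op_add (jack_op_add j2 (jZ _ _ cc1 j1)) (jZ _ _ cc2 j0)) => f.
  rewrite sumE /coef0 !mulr_sumr -!big_split; apply: eq_bigr => I Ir /=.
  by have [] := expand I f Ir.
apply: eq_jack_op (jack_op_add (jack_op_add (jack_op_add j3 (jZ _ _ cc1 j2))
  (jZ _ _ cc2 j1)) (jZ _ _ cc3 j0)) => f.
rewrite sumE /coef0 !mulr_sumr -!big_split; apply: eq_bigr => I Ir /=.
by have [] := expand I f Ir.
Qed.

Lemma macdonald_comm (r s k l : nat) f : (k <= 3)%N -> (l <= 3)%N ->
  macdonald beta r k (macdonald beta s l f) = macdonald beta s l (macdonald beta r k f).
Proof.
move=> k3 l3.
apply: (jack_op_comm two (@eulerM K n : forall i x y, D i (x * y) = _) (@euler_comm K n)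
  _ (@wratio_anti K n) (@wratio_triple K n) (@euler_wratio K n two) f
  (macdonald_jack_op r k3) (macdonald_jack_op s l3)) => i.
exact: euler_const.
Qed.

End Expansion.

Theorem corollary6p3 (K : fieldType) (char0 : [pchar K] =i pred0)
    (n : nat) (beta : K) (i j r s : nat)
    (hi : (i <= 3)%N) (hj : (j <= 3)%N)
    (hr : (1 <= r <= n)%N) (hs : (1 <= s <= n)%N)
    (f : {mpoly K[n]}) (hf : f \is symmetric) :
  opcommutator (@macdonald K n beta r i) (@macdonald K n beta s j)
    (FracField.tofrac f) = 0.
Proof.
rewrite /opcommutator (macdonald_comm beta char0 r s (FracField.tofrac f) hi hj).
exact: subrr.
Qed.
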